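(* Let $U^n$ be a lightlike hypersurface of the de Sitter space $S^{n+1}_1\subset P^{n+1}$. Then $U^n$ is the image of the direct product $M^{n-1}\times l$ of a differentiable manifold $M^{n-1}$ of dimension $n-1$ and a projective line $l$ under a mapping $f: M^{n-1}\times l\to P^{n+1}$, that is, $U^n=f(M^{n-1}\times l)$, where $f$ sends (for each fixed point of $M^{n-1}$) the line $l$ to a straight line $A_nA_0\subset P^{n+1}$ joining a point $x=A_n$ of $U^n$ with the point $A_0$ at which the tangent hyperplane $T_x(U^n)$ touches the absolute $Q^n$.
   Context: Let $(\cdot,\cdot)$ be a quadratic form of signature $(n+1,1)$ on $\mathbb{R}^{n+2}$, let $P^{n+1}$ be the associated real projective space, and let $Q^n=\{(x,x)=0\}\subset P^{n+1}$ be the corresponding oval hyperquadric (the absolute). The de Sitter space $S^{n+1}_1$ is identified with the exterior domain $\{(x,x)>0\}$ of $Q^n$ in $P^{n+1}$; with points normalized by $(x,x)=1$, its pseudo-Riemannian metric is $(dx,dx)$, of Lorentzian signature $(n,1)$. A hypersurface $U^n$ ($\dim U^n=n$) of $S^{n+1}_1$ is called lightlike if each of its tangent hyperplanes $\eta=T_x(U^n)$ (a projective hyperplane of $P^{n+1}$ through $x$) is tangent to $Q^n$; write $A_n=x$ and $A_0$ for the point of tangency of $\eta$ with $Q^n$. The straight line $A_nA_0$ is an isotropic (null) line of $S^{n+1}_1$. Standing conventions: all functions are real and differentiable, and all manifolds are smooth with the possible exception of isolated singular points and singular submanifolds. It is assumed that whenever $x=A_n\in U^n$, the entire projective straight line $A_nA_0$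 belongs to $U^n$ (so $U^n$ is completed to a subset of $P^{n+1}$ containing these whole lines, possibly with singular points at which the tangent hyperplane is not defined by differentiation). *)

(* Defs.v *)
From mathcomp Require Export all_boot all_order all_algebra.
From mathcomp Require Export all_classical all_reals all_analysis.
Export Order.TTheory GRing.Theory Num.Theory.
Export numFieldNormedType.Exports.

Set Implicit Arguments.
Unset Strict Implicit.
Unset Printing Implicit Defensive.

Global Open Scope classical_set_scope.
Global Open Scope ring_scope.

Fixpoint Ck_on (R : realType) (V W : normedModType R) (k : nat)
    (D : set V) (f : V -> W) : Prop :=
  match k with
  | 0 => forall x, D x -> {for x, continuous f}
  | k'.+1 => (forall x, D x -> differentiable f x) /\
             (forall v, Ck_on k' D (fun x => 'D_v f x))
  end.

(* Meant for open D: the derivatives are not taken relatively to D. *)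
Definition smooth_on (R : realType) (V W : normedModType R)
    (D : set V) (f : V -> W) : Prop :=
  forall k, Ck_on k D f.

(* A smooth manifold without boundary, possibly empty or disconnected; the
   values of chart_map i off chart_dom i, and those of chart_inv i off
   chart_map i @` chart_dom i, are irrelevant. *)
Record manifold (R : realType) (d : nat) := Manifold {
  points :> topologicalType;
  chart : Type;
  chart_dom : chart -> set points;
  chart_map : chart -> points -> 'rV[R]_d;
  chart_inv : chart -> 'rV[R]_d -> points;
  points_hausdorff : hausdorff_space points;
  points_second_countable : @second_countable points;
  chart_cover : forall x, exists i, chart_dom i x;
  chart_dom_open : forall i, open (chart_dom i);
  chart_img_open : forall i, open (chart_map i @` chart_dom i);
  chart_mapK :
    forall i x, chart_dom i x -> chart_inv i (chart_map i x) = x;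
  chart_map_continuous :
    forall i x, chart_dom i x -> {for x, continuous (chart_map i)};
  chart_inv_continuous :
    forall i y, (chart_map i @` chart_dom i) y ->
      {for y, continuous (chart_inv i)};
  chart_transition : forall i j,
    smooth_on (chart_map i @` (chart_dom i `&` chart_dom j))
              (chart_map j \o chart_inv i)
}.

(* A point of P^N is a line through 0 in R^(N+1). *)
Record pspace (R : realType) (N : nat) := PPoint {
  pline :> {vspace 'rV[R]_N.+1};
  pline_dim : \dim pline == 1%N
}.
Definition join_line (R : realType) (N : nat) (p q : pspace R N)
    : set (pspace R N) :=
  [set r | (r <= p + q)%VS].

(* h is a field of homogeneous coordinates of phi around x, written in the
   chart i. It does not vanish at the points where the equation is required,
   because phi z has dimension 1. *)
Definition local_lift (R : realType) (d N : nat) (X : manifold R d)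
    (phi : X -> pspace R N) (x : X) (i : chart X)
    (D : set 'rV[R]_d) (h : 'rV[R]_d -> 'rV[R]_N.+1) : Prop :=
  [/\ chart_dom i x, open D, D (chart_map i x), smooth_on D h
    & forall z, chart_dom i z -> D (chart_map i z) ->
        phi z = <[h (chart_map i z)]>%VS :> {vspace _}].

Definition smooth_map (R : realType) (d N : nat) (X : manifold R d)
    (phi : X -> pspace R N) : Prop :=
  forall x, exists i D h, local_lift phi x i D h.

(* Smoothness on the product manifold X * P^k: as the canonical map
   R^(k+1) \ {0} -> P^k is a surjective submersion, smoothness in the variable
   of P^k is tested on its homogeneous coordinates. *)
Definition smooth_prod_map (R : realType) (d k N : nat) (X : manifold R d)
    (f : X -> pspace R k -> pspace R N) : Prop :=
  forall (x : X) (a : 'rV[R]_k.+1), a != 0 ->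
  exists (i : chart X) (D : set 'rV[R]_(d + k.+1))
         (h : 'rV[R]_(d + k.+1) -> 'rV[R]_N.+1),
    [/\ chart_dom i x, open D, D (row_mx (chart_map i x) a), smooth_on D h
      & forall z b (t : pspace R k),
          chart_dom i z -> D (row_mx (chart_map i z) b) ->
          t = <[b]>%VS :> {vspace _} ->
          f z t = <[h (row_mx (chart_map i z) b)]>%VS :> {vspace _}].

(* T is the linear subspace of R^(N+1) whose projectivization is the projective
   tangent subspace of phi at x: it is spanned by a lift of phi and its partial
   derivatives, and depends neither on the lift nor on the chart. *)
Definition tangent_space (R : realType) (d N : nat) (X : manifold R d)
    (phi : X -> pspace R N) (x : X) (T : {vspace 'rV[R]_N.+1}) : Prop :=
  exists i D h, local_lift phi x i D h /\
    T = (<[h (chart_map i x)]> +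
         \sum_(k < d) <['D_(delta_mx ord0 k) h (chart_map i x)]>)%VS.

Definition qform (R : realType) (m : nat) (G : 'M[R]_m) (v : 'rV[R]_m) : R :=
  (v *m G *m v^T) ord0 ord0.

Definition has_signature (R : realType) (m : nat) (p q : nat) (G : 'M[R]_m)
    : Prop :=
  [/\ (p + q)%N = m, G^T = G
    & exists2 P : 'M[R]_m, P \in unitmx &
        P *m G *m P^T = diag_mx (\row_(j < m) (if (j < p)%N then 1 else -1))].

Definition absolute (R : realType) (N : nat) (G : 'M[R]_N.+1)
    : set (pspace R N) :=
  [set p | forall v, v \in pline p -> qform G v = 0].

(* The de Sitter space, as the exterior of the absolute. *)
Definition de_sitter (R : realType) (N : nat) (G : 'M[R]_N.+1)
    : set (pspace R N) :=
  [set p | forall v, v \in pline p -> v != 0 -> 0 < qform G v].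

(* The hyperplane T is tangent to the absolute at p: it is the kernel of the
   differential of the quadratic form at a representative of p. *)
Definition touches_at (R : realType) (N : nat) (G : 'M[R]_N.+1)
    (T : {vspace 'rV[R]_N.+1}) (p : pspace R N) : Prop :=
  absolute G p /\
  exists2 a : 'rV[R]_N.+1, pline p = <[a]>%VS
    & forall y, y \in T <-> 'D_y (qform G) a = 0.

(* The regular part of the hypersurface is immersed, not necessarily embedded;
   the dimension condition says that phi is an immersion, i.e. that its tangent
   spaces are projective hyperplanes of P^(n+1). *)
Record lightlike_hypersurface (R : realType) (n : nat) (G : 'M[R]_n.+2)
    (X : manifold R n) (phi : X -> pspace R n.+1) : Prop := {
  lh_smooth : smooth_map phi;
  lh_de_sitter : forall x, de_sitter G (phi x);
  lh_immersion : forall x T, tangent_space phi x T -> \dim T = n.+1;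
  lh_lightlike : forall x T, tangent_space phi x T ->
    exists A0, touches_at G T A0
}.

(* L is the projective line joining x and the point where the tangent
   hyperplane at x touches the absolute. *)
Definition generator (R : realType) (n : nat) (G : 'M[R]_n.+2)
    (X : manifold R n) (phi : X -> pspace R n.+1) (x : X)
    (L : set (pspace R n.+1)) : Prop :=
  exists T A0, [/\ tangent_space phi x T, touches_at G T A0
                 & L = join_line (phi x) A0].

(* The hypersurface completed by the whole lines through its points, including
   their points on the absolute and their singular points. *)
Definition completed (R : realType) (n : nat) (G : 'M[R]_n.+2)
    (X : manifold R n) (phi : X -> pspace R n.+1) : set (pspace R n.+1) :=
  [set p | exists x L, generator G phi x L /\ L p].

(* Main.v *)
Require Import Defs.
From mathcomp Require Import ring lra.

Set Implicit Arguments.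
Unset Strict Implicit.
Unset Printing Implicit Defensive.

(** Let [h] be a local lift of the hypersurface and [a] the vector polar to its
    tangent hyperplane, which represents the point of contact with the absolute.
    There is a tangent direction [N] along which [h] moves into the span of [h]
    and [a]; the symmetry of second derivatives then gives [D_N a = mu a], so the
    plane [h, a] is infinitesimally constant along [N], that is, its Pluecker
    coordinates are multiplied by a common factor.

    Hence every generator close to [x0] already occurs on a coordinate slice
    transversal to [N] through [x0].  Instead of integrating [N], follow it by
    Euler polygons: the ratios of the Pluecker coordinates change by [o(step)] at
    each step, uniformly on compact sets, so the polygons reach the slice at
    points whose generators approximate the given one arbitrarily well, and the
    compactness of the slice yields an exact solution.

    By Lindeloef, countably many slices meet all the generators; [M] is the
    disjoint union of these slices. *)

(** * Calculus *)

(** The space of integral curves of [N] need not be Hausdorff, so no quotient is formed: a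
    coordinate slice has a chart at once. One generator may then occur in several slices, or several
    times in one. This is harmless, because the mapping has to be bijective along each line only,
    while its total image has to be the completed hypersurface.

    Pluecker coordinates are followed because the vector [h] is not constant up to a factor: along
    [N] it slides inside the plane [[h, a]]. The unknown common factor disappears on division by one
    coordinate that is nonzero near [x0]. No actual integral curve is needed: if the ratios are
    stationary to first order at every point, the errors of the polygon add up to a number of steps
    times [o(step)], which tends to zero.

    The plane never degenerates, as [h] has positive square and is orthogonal to [a]. Both [a] and
    [N] are built from cofactors of a matrix containing [h] and its first derivatives, so they are
    smooth without any division or choice of representatives. *)

Section smooth_calculus.
Context {R : realType}.
Implicit Types V W : normedModType R.

Lemma near_eq_differentiable V W (f g : V -> W) (x : V) :
  (\near x, f x = g x) -> differentiable f x -> differentiable g x.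
Proof.
move=> fg /diff_locallyP[dc /eqaddoP dfo].
have go : g \o shift x = cst (g x) + 'd f x +o_ (0 : V) id.
  apply/eqaddoP => e e0; have := dfo e e0.
  have : \forall y \near 0, f (y + x) = g (y + x).
    by move: fg; rewrite (near_shift 0)/= subr0.
  apply: filterS2 => y fgy /=.
  by rewrite /= -![(_ - _ : _ -> _) _]/(_ - _) /= fgy -(nbhs_singleton fg).
by apply/diff_locallyP; rewrite (diff_unique dc go).
Qed.

Lemma near_open V (D : set V) (P : V -> Prop) (x : V) :
  open D -> D x -> (forall x, D x -> P x) -> \near x, P x.
Proof. by move=> oD Dx DP; apply: filterS (open_nbhs_nbhs (conj oD Dx)). Qed.

Lemma Ck_on_ext V W k (D : set V) (f g : V -> W) :
  open D -> Ck_on k D f -> (forall x, D x -> f x = g x) -> Ck_on k D g.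
Proof.
move=> oD + fg; elim: k f g fg => [|k IH] f g fg /=.
  move=> fc x Dx; suff : g @ x --> g x by [].
  rewrite -fg //; apply: cvg_trans (fc x Dx); apply/near_eq_cvg.
  exact: (@near_open _ D (fun y => f y = g y)).
move=> [fd fD]; split.
  by move=> x Dx; apply: near_eq_differentiable (fd x Dx); exact: near_open fg.
move=> v; apply: IH (fD v) => x Dx.
by apply: near_eq_derive; exact: near_open fg.
Qed.

Lemma Ck_onW V W k (D : set V) (f : V -> W) : Ck_on k.+1 D f -> Ck_on k D f.
Proof.
elim: k f => [|k IH] f [fd fD] /=.
  by move=> x Dx; exact: differentiable_continuous (fd x Dx).
by split=> // v; apply: IH; exact: fD.
Qed.

Lemma Ck_on_sub V W k (D E : set V) (f : V -> W) :
  E `<=` D -> Ck_on k D f -> Ck_on k E f.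
Proof.
move=> ED; elim: k f => [|k IH] f /=; first by move=> fc x /ED; exact: fc.
by move=> [fd fD]; split=> [x /ED|v]; [exact: fd|exact: IH].
Qed.

Lemma Ck_cst V W k (D : set V) (c : W) : Ck_on k D (fun=> c).
Proof.
elim: k c => [|k IH] c /=; first by move=> x _; exact: cst_continuous.
split=> [x _|v]; first exact: differentiable_cst.
have -> : (fun x => 'D_v (fun=> c) x) = (fun _ : V => 0 : W); last exact: IH.
by apply/funext => x; exact: derive_cst.
Qed.

Lemma Ck_add V W k (D : set V) (f g : V -> W) :
  open D -> Ck_on k D f -> Ck_on k D g -> Ck_on k D (fun x => f x + g x).
Proof.
move=> oD; elim: k f g => [|k IH] f g /=.
  by move=> fc gc x Dx; apply: continuousD; [exact: fc|exact: gc].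
move=> [fd fD] [gd gD]; split=> [x Dx|v].
  by apply: differentiableD; [exact: fd|exact: gd].
apply: (Ck_on_ext oD (IH _ _ (fD v) (gD v))) => x Dx.
by rewrite -deriveD //; apply: diff_derivable; [exact: fd|exact: gd].
Qed.

Lemma Ck_mul V k (D : set V) (f g : V -> R) :
  open D -> Ck_on k D f -> Ck_on k D g -> Ck_on k D (fun x => f x * g x).
Proof.
move=> oD; elim: k f g => [|k IH] f g.
  by move=> fc gc x Dx; apply: continuousM; [exact: fc|exact: gc].
move=> fk gk; case: (fk) (gk) => [fd fD] [gd gD]; split=> [x Dx|v].
  by apply: differentiableM; [exact: fd|exact: gd].
apply: (Ck_on_ext oD (Ck_add oD (IH _ _ (Ck_onW fk) (gD v))
                                  (IH _ _ (Ck_onW gk) (fD v)))) => x Dx.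
by symmetry; apply: deriveM; apply: diff_derivable; [exact: fd|exact: gd].
Qed.

Lemma derive_scalel V W (f : V -> R) (c : W) (x v : V) :
  differentiable f x -> 'D_v (fun y => f y *: c) x = 'D_v f x *: c.
Proof.
by move=> fd; rewrite !deriveE ?diffZl //; exact: differentiableZl.
Qed.

Lemma Ck_scalel V W k (D : set V) (f : V -> R) (c : W) :
  open D -> Ck_on k D f -> Ck_on k D (fun x => f x *: c).
Proof.
move=> oD; elim: k f => [|k IH] f /=.
  by move=> fc x Dx; apply: continuousZr_tmp; exact: fc.
move=> [fd fD]; split=> [x Dx|v]; first exact/differentiableZl/fd.
apply: (Ck_on_ext oD (IH _ (fD v))) => x Dx.
by rewrite derive_scalel //; exact: fd.
Qed.

Lemma Ck_sum V W k (D : set V) (I : Type) (s : seq I) (P : pred I)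
    (f : I -> V -> W) :
  open D -> (forall i, P i -> Ck_on k D (f i)) ->
  Ck_on k D (fun x => \sum_(i <- s | P i) f i x).
Proof.
move=> oD fk; elim: s => [|i s IH].
  by apply: (Ck_on_ext oD (Ck_cst k D 0)) => x _; rewrite big_nil.
case Pi : (P i); last by apply: (Ck_on_ext oD IH) => x _; rewrite big_cons Pi.
by apply: (Ck_on_ext oD (Ck_add oD (fk i Pi) IH)) => x _; rewrite big_cons Pi.
Qed.

Lemma Ck_prod V k (D : set V) (I : Type) (s : seq I) (f : I -> V -> R) :
  open D -> (forall i, Ck_on k D (f i)) ->
  Ck_on k D (fun x => \prod_(i <- s) f i x).
Proof.
move=> oD fk; elim: s => [|i s IH].
  have c1 : Ck_on k D (fun _ : V => 1 : R) by exact: Ck_cst.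
  by apply: (Ck_on_ext oD c1) => x _; rewrite big_nil.
by apply: (Ck_on_ext oD (Ck_mul oD (fk i) IH)) => x _; rewrite big_cons.
Qed.

(** The derivative of [f \o A] along [v] is ['D_(L v) f] composed with [A]. As the direction [L v]
    is constant, it has the same shape as [f \o A], and the induction on [k] closes. *)
Lemma Ck_comp_affine V W V' k (D : set V') (f : V' -> W) (A L : V -> V') :
  open D -> (forall x, differentiable A x) -> (forall x v, 'D_v A x = L v) ->
  Ck_on k D f -> Ck_on k (A @^-1` D) (f \o A).
Proof.
move=> oD Ad AL; have cA : continuous A.
  by move=> x; exact: differentiable_continuous.
have oAD : open (A @^-1` D) by apply: open_comp => // x _; exact: cA.
elim: k f => [|k IH] f /=.
  by move=> fc x Dx; apply: continuous_comp; [exact: cA|exact: fc].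
move=> [fd fD]; split=> [x Dx|v].
  by apply: differentiable_comp => //; exact: fd.
apply: (Ck_on_ext oAD (IH _ (fD (L v)))) => x Dx /=.
have dfA := differentiable_comp (Ad x) (fd _ Dx).
rewrite -(AL x v) (deriveE v (Ad x)) (deriveE _ (fd _ Dx)) (deriveE v dfA).
by rewrite (diff_comp (Ad x) (fd _ Dx)).
Qed.

Lemma differentiable_entry V m n (f : V -> 'M[R]_(m, n)) i j (x : V) :
  differentiable f x -> differentiable (fun y => f y i j) x.
Proof.
move=> fd; apply: (@differentiable_comp _ _ _ _ f (fun M => M i j)) => //.
exact: differentiable_coord.
Qed.

Lemma derive_entry V m n (f : V -> 'M[R]_(m, n)) i j (x v : V) :
  differentiable f x -> 'D_v (fun y => f y i j) x = ('D_v f x) i j.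
Proof. by move=> fd; rewrite derive_mx ?mxE //; exact: diff_derivable. Qed.

Lemma Ck_entry V m n k (D : set V) (f : V -> 'M[R]_(m, n)) i j :
  open D -> Ck_on k D f -> Ck_on k D (fun x => f x i j).
Proof.
move=> oD; elim: k f => [|k IH] f /=.
  move=> fc x Dx; apply: (@continuous_comp _ _ _ f (fun M => M i j)).
    exact: fc.
  exact: coord_continuous.
move=> [fd fD]; split=> [x Dx|v]; first exact/differentiable_entry/fd.
by apply: (Ck_on_ext oD (IH _ (fD v))) => x Dx; rewrite derive_entry //; exact: fd.
Qed.

Lemma Ck_row V n k (D : set V) (f : V -> 'rV[R]_n) :
  open D -> (forall j, Ck_on k D (fun x => f x ord0 j)) -> Ck_on k D f.
Proof.
move=> oD fk.
have sumk : Ck_on k D (fun x => \sum_j f x ord0 j *: delta_mx ord0 j : 'rV[R]_n).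
  apply: Ck_sum => //.
  by move=> j _; exact: Ck_scalel.
by apply: (Ck_on_ext oD sumk) => x _; rewrite -row_sum_delta.
Qed.

Lemma Ck_det V n k (D : set V) (M : V -> 'M[R]_n) :
  open D -> (forall i j, Ck_on k D (fun x => M x i j)) ->
  Ck_on k D (fun x => \det (M x)).
Proof.
move=> oD Mk.
apply: Ck_sum => // s _; apply: Ck_mul => //; first exact: Ck_cst.
by apply: Ck_prod.
Qed.

Lemma smooth_derive V W (D : set V) (f : V -> W) (v : V) :
  smooth_on D f -> smooth_on D (fun x => 'D_v f x).
Proof. by move=> fs k; have [_] := fs k.+1; exact. Qed.

Lemma smooth_differentiable V W (D : set V) (f : V -> W) x :
  smooth_on D f -> D x -> differentiable f x.
Proof. by move=> fs; have [fd _] := fs 1%N; exact: fd. Qed.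

Lemma smooth_continuous V W (D : set V) (f : V -> W) x :
  smooth_on D f -> D x -> {for x, continuous f}.
Proof.
move=> fs Dx; exact: differentiable_continuous (smooth_differentiable fs Dx).
Qed.

Lemma linear_rV_differentiable W n (f : {linear 'rV[R]_n -> W}) (x : 'rV[R]_n) :
  differentiable f x.
Proof.
have -> : (f : 'rV[R]_n -> W) =
    \sum_(j < n) (fun y : 'rV[R]_n => y ord0 j *: f (delta_mx ord0 j)).
  apply/funext => y; rewrite fct_sumE {1}[y]row_sum_delta linear_sum.
  by under eq_bigr do rewrite linearZ.
apply: differentiable_sum => j; exact/differentiableZl/differentiable_coord.
Qed.

Lemma linear_rV_continuous W n (f : {linear 'rV[R]_n -> W}) : continuous f.
Proof. by move=> x; exact/differentiable_continuous/linear_rV_differentiable. Qed.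

Lemma derive_linear_rV W n (f : {linear 'rV[R]_n -> W}) (x v : 'rV[R]_n) :
  'D_v f x = f v.
Proof.
rewrite deriveE ?diff_lin //; first exact: linear_rV_continuous.
exact: linear_rV_differentiable.
Qed.

Lemma differentiable_affine_rV W n (f : {linear 'rV[R]_n -> W}) (c : W) x :
  differentiable (fun y => c + f y) x.
Proof.
apply: differentiableD; [exact: differentiable_cst|exact: linear_rV_differentiable].
Qed.

Lemma derive_affine_rV W n (f : {linear 'rV[R]_n -> W}) (c : W) x v :
  'D_v (fun y => c + f y) x = f v.
Proof.
rewrite [LHS]deriveD ?derive_linear_rV ?derive_cst ?add0r //; apply: diff_derivable.
exact: linear_rV_differentiable.
Qed.

Lemma Ck_linear_rV W n k (D : set 'rV[R]_n) (f : {linear 'rV[R]_n -> W}) :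
  Ck_on k D f.
Proof.
case: k => [|k] /=; first by move=> x _; exact: linear_rV_continuous.
split=> [x _|v]; first exact: linear_rV_differentiable.
have -> : (fun x => 'D_v f x) = (fun=> f v); last exact: Ck_cst.
by apply/funext => x; exact: derive_linear_rV.
Qed.

Lemma smooth_mulmx V (D : set V) p q (f : V -> 'rV[R]_p) (M : V -> 'M[R]_(p, q)) :
  open D -> smooth_on D f -> (forall i j, smooth_on D (fun v => M v i j)) ->
  smooth_on D (fun v => f v *m M v).
Proof.
move=> oD fs Ms k; apply: Ck_row => // j.
have -> : (fun v => (f v *m M v) ord0 j) = (fun v => \sum_i f v ord0 i * M v i j).
  by apply/funext => v; rewrite mxE.
apply: Ck_sum => // i _; apply: Ck_mul => //; last exact: Ms.
by apply: Ck_entry => //; exact: fs.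
Qed.

Lemma derive_zero_on V W (D : set V) (f : V -> W) (v w : V) :
  open D -> D v -> (forall v, D v -> f v = 0) -> 'D_w f v = 0.
Proof.
move=> oD Dv f0; rewrite -[RHS](@derive_cst R _ _ 0 v w).
by apply: near_eq_derive; exact: near_open f0.
Qed.

End smooth_calculus.

(** * Mean value theorem, symmetry of second derivatives, uniform continuity *)

Section mean_value.
Context {R : realType}.
Implicit Types V : normedModType R.

Lemma is_derive_line V (f : V -> R) (x v : V) (t : R) :
  differentiable f (x + t *: v) ->
  is_derive t 1 (fun s : R => f (x + s *: v)) ('D_v f (x + t *: v)).
Proof.
move=> fd; have fv : derivable f (x + t *: v) v := diff_derivable fd.
have e : (fun h => h^-1 *: (((fun s : R => f (x + s *: v)) \o shift t) (h *: 1)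
            - f (x + t *: v))) =
         (fun h => h^-1 *: ((f \o shift (x + t *: v)) (h *: v) - f (x + t *: v))).
  apply/funext => h /=; congr (_ *: (f _ - _)).
  by rewrite [h *: 1]mulr1 scalerDl addrCA.
by split; rewrite /derivable /derive e.
Qed.

Lemma mean_value0 (g dg : R -> R) (s : R) : 0 <= s ->
  (forall t, 0 <= t <= s -> is_derive t 1 g (dg t)) ->
  exists2 c, 0 <= c <= s & g s - g 0 = dg c * s.
Proof.
move=> s0 gd.
have [||c] := @MVT_segment R g dg 0 s s0.
- by move=> t; rewrite in_itv /= => /andP[t0 ts]; apply: gd; rewrite !ltW.
- apply: derivable_within_continuous => t; rewrite in_itv /= => /gd ?.
  exact: ex_derive.
by rewrite in_itv /= subr0 => cs e; exists c.
Qed.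

Lemma mean_value_line V (f : V -> R) (x v : V) :
  (forall t, 0 <= t <= 1 -> differentiable f (x + t *: v)) ->
  exists2 t, 0 <= t <= 1 & f (x + v) - f x = 'D_v f (x + t *: v).
Proof.
move=> fd.
have [|t t01 e] := @mean_value0 (fun t => f (x + t *: v))
  (fun t => 'D_v f (x + t *: v)) 1 ler01.
  by move=> t /fd; exact: is_derive_line.
by exists t => //; move: e; rewrite scale1r scale0r addr0 mulr1.
Qed.

(** The mean value theorem is applied twice: to the increment of [f] under [s *: w], as a function
    of the displacement along [v], and then to ['D_v f] along [w]. *)
Lemma second_difference V (f : V -> R) (D : set V) (x v w : V) (s : R) :
  0 <= s -> Ck_on 2 D f ->
  (forall a b, 0 <= a <= s -> 0 <= b <= s -> D (x + a *: v + b *: w)) ->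
  exists a b, [/\ 0 <= a <= s, 0 <= b <= s &
    f (x + s *: w + s *: v) - f (x + s *: v) - (f (x + s *: w) - f x)
      = 'D_w ('D_v f) (x + a *: v + b *: w) * s * s].
Proof.
move=> s0 [fd fD] inD.
have s0s : 0 <= s <= s by apply/andP.
have s00 : (0 : R) <= 0 <= s by rewrite lexx s0.
have dfw t : 0 <= t <= s -> differentiable f (x + s *: w + t *: v).
  by move=> ts; apply: fd; rewrite addrAC; exact: inD.
have dfv t : 0 <= t <= s -> differentiable f (x + t *: v).
  by move=> ts; apply: fd; have := inD _ _ ts s00; rewrite scale0r addr0.
have [|a a0s ea] := @mean_value0
  (fun t => f (x + s *: w + t *: v) - f (x + t *: v))
  (fun t => 'D_v f (x + s *: w + t *: v) - 'D_v f (x + t *: v)) s s0.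
  move=> t ts; have := is_derive_line (dfw t ts); have := is_derive_line (dfv t ts).
  by move=> ? ?; exact: is_deriveB.
have [|b b0s eb] := @mean_value0 (fun t => 'D_v f (x + a *: v + t *: w))
  (fun t => 'D_w ('D_v f) (x + a *: v + t *: w)) s s0.
  move=> t ts; apply: is_derive_line.
  by have [vd _] := fD v; apply: vd; exact: inD.
exists a, b; split => //.
move: ea eb; rewrite !scale0r !addr0 => -> eb.
by rewrite -eb [x + s *: w + _]addrAC.
Qed.

(** The second difference is symmetric in [v] and [w], so the two mixed derivatives take a common
    value at points arbitrarily close to [x]; continuity carries the equality to [x]. *)
Lemma derive_comm V (f : V -> R) (D : set V) (x v w : V) :
  open D -> D x -> Ck_on 2 D f -> 'D_w ('D_v f) x = 'D_v ('D_w f) x.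
Proof.
move=> oD Dx f2; apply/eqP/negPn/negP => ne.
have tri (a b c e : R) : e + e = `|a - b| -> `|a - c| < e -> `|b - c| < e -> False.
  move=> ee ac bc; have := ler_distD c a b.
  by rewrite -ee (distrC c) leNgt ltrD.
have [e e0 ee2] : exists2 e, 0 < e & e + e = `|'D_w ('D_v f) x - 'D_v ('D_w f) x|.
  exists (`|'D_w ('D_v f) x - 'D_v ('D_w f) x| / 2); last by rewrite -splitr.
  by rewrite divr_gt0 // normr_gt0 subr_eq0.
have cont v1 v2 : {for x, continuous ('D_v1 ('D_v2 f))}.
  by have [_ /(_ v2)] := f2; move=> [_ /(_ v1)]; apply.
have c1 : \forall y \near x, `|'D_w ('D_v f) x - 'D_w ('D_v f) y| < e.
  by have /cvgrPdist_lt/(_ e e0) := cont w v.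
have c2 : \forall y \near x, `|'D_v ('D_w f) x - 'D_v ('D_w f) y| < e.
  by have /cvgrPdist_lt/(_ e e0) := cont v w.
have c3 : \forall y \near x, D y by exact: open_nbhs_nbhs.
have : nbhs x [set y | D y /\ (`|'D_w ('D_v f) x - 'D_w ('D_v f) y| < e
    /\ `|'D_v ('D_w f) x - 'D_v ('D_w f) y| < e)].
  exact: filterI c3 (filterI c1 c2).
move=> /nbhs_ballP[d /= d0 Hd].
(* The parallelogram with sides [s *: v] and [s *: w] must fit into the ball of radius [d]; the
   [+ 1] covers [v = w = 0]. *)
pose s := d / 2 / (`|v| + `|w| + 1).
have vw : 0 < `|v| + `|w| + 1 by rewrite ltr_wpDl.
have s0 : 0 < s by rewrite !divr_gt0.
have sd : s * (`|v| + `|w|) < d.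
  apply: (@le_lt_trans _ _ (s * (`|v| + `|w| + 1))).
    by rewrite ler_pM2l // lerDl.
  by rewrite divfK ?gt_eqF // ltr_pdivrMr // ltr_pMr // ltr1n.
have near v1 v2 a b : `|v1| + `|v2| = `|v| + `|w| -> 0 <= a <= s -> 0 <= b <= s ->
    ball x d (x + a *: v1 + b *: v2).
  move=> v12 /andP[a0 las] /andP[b0 lbs]; rewrite -ball_normE /=.
  rewrite -addrA opprD addNKr normrN.
  apply: le_lt_trans sd; rewrite (le_trans (ler_normD _ _)) // !normrZ !ger0_norm //.
  by rewrite -v12 mulrDr lerD // ler_wpM2r.
have [|a [b [ass bs eab]]] := second_difference (ltW s0) f2 (v := v) (w := w) (x := x).
  by move=> a b ass bs; have [] := Hd _ (near v w a b erefl ass bs).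
have [|a' [b' [as' bs' eab']]] := 
    second_difference (ltW s0) f2 (v := w) (w := v) (x := x).
  by move=> a' b' as' bs'; have [] := Hd _ (near w v a' b' (addrC _ _) as' bs').
have [_ [h1 _]] := Hd _ (near v w a b erefl ass bs).
have [_ [_ h2]] := Hd _ (near w v a' b' (addrC _ _) as' bs').
have ee : 'D_w ('D_v f) (x + a *: v + b *: w) = 'D_v ('D_w f) (x + a' *: w + b' *: v).
  have cancel (a1 a2 b1 b2 : R) : a1 = b1 * s * s -> a2 = b2 * s * s -> a1 = a2 ->
      b1 = b2.
    by move=> -> -> /mulIf -/(_ (lt0r_neq0 s0)) /mulIf -/(_ (lt0r_neq0 s0)).
  have swap (a1 a2 a3 a4 : R) : a1 - a2 - (a3 - a4) = a1 - a3 - (a2 - a4) by ring.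
  apply: (cancel _ _ _ _ eab eab'); rewrite swap.
  by rewrite [x + s *: v + s *: w]addrAC.
rewrite ee in h1.
exact: tri ee2 h1 h2.
Qed.

Lemma uniform_continuity V (K : set V) (f : V -> R) :
  compact K -> (forall x, K x -> {for x, continuous f}) ->
  forall e, 0 < e -> exists2 d, 0 < d &
    forall x y, K x -> `|x - y| < d -> `|f x - f y| < e.
Proof.
move=> /compact_near_coveringP cK fc e e0.
pose P (d : R) (x : V) := forall y, `|x - y| < d -> `|f x - f y| < e.
have cov : \forall d \near (0:R)^'+, K `<=` P d.
  apply: cK => x Kx.
  have e2 : 0 < e / 2 by rewrite divr_gt0.
  have /cvgrPdist_lt/(_ _ e2)/nbhs_ballP[d /= d0 Hd] := fc x Kx.
  exists (ball x (d / 2), [set d' : R | 0 < d' < d / 2]) => /=.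
    split; first by apply: nbhsx_ballx; rewrite divr_gt0.
    near=> d'; apply/andP; split; near: d'; first exact: nbhs_right_gt.
    by apply: nbhs_right_lt; rewrite divr_gt0.
  move=> [y d'] /=; rewrite -ball_normE /= => -[xy /andP[d'0 d'd]] z yz.
  have h1 : `|f x - f y| < e / 2 by apply: Hd; rewrite -ball_normE /=; lra.
  have h2 : `|f x - f z| < e / 2.
    apply: Hd; rewrite -ball_normE /= -(subrK y x) -addrA.
    by rewrite (le_lt_trans (ler_normD _ _)) //; lra.
  rewrite -(subrK (f x) (f y)) -addrA (le_lt_trans (ler_normD _ _)) //.
  by rewrite distrC [ltRHS]splitr ltrD.
near (0:R)^'+ => d.
exists d; first by near: d; exact: nbhs_right_gt.
have h : K `<=` P d by near: d; exact: cov.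
by move=> x y Kx xy; exact: (h x Kx y).
Unshelve. all: by end_near. Qed.

Lemma derive_rV_sum n (f : 'rV[R]_n -> R) (x w : 'rV[R]_n) :
  differentiable f x ->
  'D_w f x = \sum_j w ord0 j * 'D_(delta_mx ord0 j) f x.
Proof.
move=> fd; rewrite deriveE // {1}[w]row_sum_delta linear_sum.
by apply: eq_bigr => j _; rewrite linearZ -deriveE.
Qed.

Lemma ler_entry_norm n (w : 'rV[R]_n) j : `|w ord0 j| <= `|w|.
Proof.
rewrite [leRHS]/Num.Def.normr /= mx_normrE.
exact: (le_bigmax _ (fun i : 'I_1 * 'I_n => `|w i.1 i.2|) (ord0, j)).
Qed.

End mean_value.

(** * Euler polygons *)

Section euler.
Context {R : realType} {n : nat} {I : finType}.
Variables (u : I -> 'rV[R]_n -> R) (i0 : I) (v0 : 'rV[R]_n) (r : R).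

Let B := [set v : 'rV[R]_n | `|v - v0| <= r].

Hypothesis r_gt0 : 0 < r.
Hypothesis u_diff : forall i v, B v -> differentiable (u i) v.
Hypothesis du_cont : forall i k v, B v ->
  {for v, continuous ('D_(delta_mx ord0 k) (u i))}.
Hypothesis u_neq0 : forall v, B v -> u i0 v != 0.

(** Affine coordinates of the projective point with homogeneous coordinates [u]. They do not see a
    common factor, so they are stationary in a direction where every [u i] changes by the same rate
    [rho]. *)
Let q i v := u i v / u i0 v.

Let B_closed : closed B.
Proof.
have -> : B = (fun v => `|v - v0|) @^-1` [set x | x <= r] by [].
apply: closed_comp; last exact: closed_le.
by move=> v _; exact: (cvg_norm (cvgB cvg_id (cvg_cst v0))).
Qed.

Lemma closed_ballE_compact : compact B.
Proof.
apply: bounded_closed_compact; last exact: B_closed.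
exists (r + `|v0|); split; first exact: num_real.
move=> M rM v /= Bv; apply: le_trans (ltW rM).
by rewrite -(subrK v0 v) (le_trans (ler_normD _ _)) // lerD2r.
Qed.

Let B_convex v w t : B v -> B (v + w) -> 0 <= t <= 1 -> B (v + t *: w).
Proof.
move=> Bv Bw /andP[t0 t1].
rewrite /B /=; have -> : v + t *: w - v0 = (1 - t) *: (v - v0) + t *: (v + w - v0).
  have -> : v + w - v0 = w + (v - v0) by rewrite addrAC addrC.
  by rewrite scalerBl scale1r [t *: (w + _)]scalerDr [t *: w + _]addrC addrA subrK addrAC.
rewrite (le_trans (ler_normD _ _)) // !normrZ !ger0_norm ?subr_ge0 //.
have h1 : (1 - t) * `|v - v0| <= (1 - t) * r by rewrite ler_wpM2l // subr_ge0.
have h2 : t * `|v + w - v0| <= t * r by rewrite ler_wpM2l.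
by move: (lerD h1 h2); rewrite -mulrDl subrK mul1r.
Qed.

Let Bv0 : B v0.
Proof. by rewrite /B /= subrr normr0 ltW. Qed.

Let u_cont i v : B v -> {for v, continuous (u i)}.
Proof. by move=> Bv; exact/differentiable_continuous/u_diff. Qed.

Lemma ratio_step_bound : exists2 C : R, 0 < C &
  forall e, 0 < e -> exists2 d, 0 < d & forall v w i rho,
    B v -> B (v + w) -> `|w| < d -> (forall i, 'D_w (u i) v = rho * u i v) ->
    `|q i (v + w) - q i v| <= C * e * `|w|.
Proof.
have withinB (f : 'rV[R]_n -> R) : (forall v, B v -> {for v, continuous f}) ->
    {within B, continuous f}.
  by move=> fc; apply: continuous_in_subspaceT => v /[!inE]; exact: fc.
have [c c0 cu] : exists2 c : R, 0 < c & forall v, B v -> c <= `|u i0 v|.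
  have [|||v /[!inE] Bv vmin] := @EVT_min_rV R n (fun v => `|u i0 v|) B.
  - by exists v0.
  - exact: closed_ballE_compact.
  - by apply: withinB => v Bv; exact: (cvg_norm (@u_cont i0 v Bv)).
  exists `|u i0 v|; first by rewrite normr_gt0 u_neq0.
  by move=> w Bw; apply: vmin; rewrite inE.
have [M M0 uM] : exists2 M : R, 0 < M & forall i v, B v -> `|u i v| <= M.
  have bnd i : exists M : R, forall v, B v -> `|u i v| <= M.
    have [|||v /[!inE] Bv vmax] := @EVT_max_rV R n (fun v => `|u i v|) B.
    - by exists v0.
    - exact: closed_ballE_compact.
    - by apply: withinB => v Bv; exact: (cvg_norm (@u_cont i v Bv)).
    by exists `|u i v| => w Bw; apply: vmax; rewrite inE.
  have [m mP] := choice bnd.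
  exists (1 + \sum_i `|m i|).
    by rewrite ltr_pwDl // sumr_ge0.
  move=> i v Bv; apply: le_trans (mP i v Bv) _.
  rewrite (bigD1 i) //= (le_trans (ler_norm _)) //.
  by rewrite addrCA lerDl addr_ge0 // sumr_ge0.
(* The factor [n] counts the partial derivatives, [M + M] bounds the two terms of [g], and each
   denominator of [q] contributes [1 / c]. The [+ 1] makes the constant positive even for
   [n = 0]. *)
exists (n%:R * (M + M) / c / c + 1).
  by rewrite ltr_wpDl // !divr_ge0 ?mulr_ge0 ?addr_ge0 // ltW.
move=> e e0.
have unif i k : exists d : R, 0 < d /\ forall x y, B x -> `|x - y| < d ->
    `|'D_(delta_mx ord0 k) (u i) x - 'D_(delta_mx ord0 k) (u i) y| < e.
  have [d d0 dP] := uniform_continuity closed_ballE_compact (@du_cont i k) e0.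
  by exists d.
have [dd ddP] := choice (fun ik : I * 'I_n => unif ik.1 ik.2).
pose d := \big[Num.min/1]_ik dd ik.
have d0 : 0 < d by apply: lt_bigmin => // ik _; have [] := ddP ik.
exists d => // v w i rho Bv Bw wd Dw.
(* [g v = 0] and ['D_w g v = 0], so only the variation of the partial derivatives
   between [v] and [v + t *: w] contributes to [g (v + w)]. *)
pose g y := u i y *: u i0 v - u i0 y *: u i v.
have Bline t : 0 <= t <= 1 -> B (v + t *: w) by exact: B_convex.
have gdiff y : B y -> differentiable g y.
  by move=> By; apply: differentiableB; apply: differentiableZl; exact: u_diff.
have Dg y : B y -> 'D_w g y = 'D_w (u i) y * u i0 v - 'D_w (u i0) y * u i v.
  move=> By; rewrite [LHS]deriveB; first by rewrite !derive_scalel //; exact: u_diff.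
  - by apply/diff_derivable/differentiableZl; exact: u_diff.
  - by apply/diff_derivable/differentiableZl; exact: u_diff.
have [|t t01] := @mean_value_line R _ g v w.
  by move=> t /Bline /gdiff.
have By := Bline t t01; set y := v + t *: w in By *.
have vy : `|v - y| < d.
  rewrite /y opprD addNKr normrN normrZ; case/andP: t01 => t0 t1.
  by rewrite ger0_norm // (le_lt_trans _ wd) // ler_piMl.
have incr j : `|'D_w (u j) y - 'D_w (u j) v| <= n%:R * (`|w| * e).
  rewrite !derive_rV_sum; try exact: u_diff.
  rewrite -sumrB (le_trans (ler_norm_sum _ _ _)) //.
  rewrite -[n in n%:R]card_ord -sum1_card natr_sum mulr_suml ler_sum // => k _.
  rewrite mul1r -mulrBr normrM distrC ler_pM //; first exact: ler_entry_norm.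
  have [_ ddc] := ddP (j, k); apply/ltW/ddc => //.
  by apply: lt_le_trans vy _; exact: bigmin_le.
rewrite Dg // => gE.
have alg1 (a b x z : R) : a * x - b * z = (a - rho * z) * x - (b - rho * x) * z by ring.
have gv0 : g v = 0 by rewrite /g -[LHS]/(u i v * u i0 v - u i0 v * u i v) mulrC subrr.
rewrite gv0 subr0 alg1 -!Dw in gE.
have gle : `|g (v + w)| <= n%:R * (M + M) * (e * `|w|).
  rewrite gE (le_trans (ler_normB _ _)) // !normrM.
  have -> : n%:R * (M + M) * (e * `|w|) = n%:R * (`|w| * e) * M + n%:R * (`|w| * e) * M.
    by ring.
  by apply: lerD; apply: ler_pM => //; exact: uM.
have alg2 (a b x z : R) : b != 0 -> z != 0 -> a / b - x / z = (a * z - b * x) / b / z.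
  by move=> b0 z0; field; rewrite b0 z0.
have qE : q i (v + w) - q i v = g (v + w) / u i0 (v + w) / u i0 v.
  by rewrite /q alg2 //; exact: u_neq0.
apply: (@le_trans _ _ `|g (v + w) / u i0 (v + w) / u i0 v|); first by rewrite -qE.
rewrite !normrM !normfV.
have cle z : B z -> `|u i0 z|^-1 <= c^-1.
  by move=> Bz; rewrite lef_pV2 ?posrE ?normr_gt0 ?u_neq0 //; exact: cu.
apply: (@le_trans _ _ (n%:R * (M + M) * (e * `|w|) / c / c)).
  apply: ler_pM; rewrite ?divr_ge0 ?invr_ge0 //; last exact: cle.
  by apply: ler_pM; rewrite ?invr_ge0 //; exact: cle.
have -> : n%:R * (M + M) * (e * `|w|) / c / c = n%:R * (M + M) / c / c * e * `|w|.
  by rewrite !mulrA; field; rewrite gt_eqF.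
by rewrite ler_wpM2r // ler_wpM2r ?ltW // ltrDl.
Qed.

(** With the direction normalized by [N ord0 k = 1], a step [h *: N] changes the [k]-th coordinate
    by exactly [h], so equal steps land exactly on the slice; only the ratios [q] carry an error. *)
Lemma polygon_meets_slice (k : 'I_n) (C : R) : 0 < C ->
  (forall v, B v -> exists (N : 'rV[R]_n) (rho : R), [/\ `|N| <= C, N ord0 k = 1
     & forall i, 'D_N (u i) v = rho * u i v]) ->
  exists2 r', 0 < r' & forall x, `|x - v0| < r' ->
    B x /\ exists s, [/\ B s, s ord0 k = v0 ord0 k
      & exists2 c, c != 0 & forall i, u i x = c * u i s].
Proof.
move=> C0 HN; have [C1 C10 step] := ratio_step_bound.
have C1_gt0 : 0 < 1 + C by rewrite addr_gt0.
(* A polygon from [x] to the slice has length at most [C * |tau|], hence at most [C * |x - v0|];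
   together with the distance of [x] from [v0] this must not exceed [r]. *)
exists (r / (1 + C)); first by rewrite divr_gt0.
move=> x xr.
have xr' : `|x - v0| * (1 + C) <= r by rewrite -ler_pdivlMr // ltW.
have Bx : B x by apply: le_trans xr'; rewrite ler_peMr // lerDl ltW.
split => //.
pose tau := v0 ord0 k - x ord0 k.
have tau_le : `|tau| <= `|x - v0|.
  by rewrite /tau distrC; have := ler_entry_norm (x - v0) k; rewrite !mxE.
(* The bound involves the total displacement [tau] and not the number of steps: refining the polygon
   makes [e] as small as desired. *)
have approx e : 0 < e -> exists v, [/\ B v, v ord0 k = v0 ord0 k
    & forall i, `|q i v - q i x| <= C1 * e * (C * `|tau|)].
  move=> e0; have [d d0 dstep] := step e e0.
  have [K Kbig] : exists K : nat, C * `|tau| / d < K.+1%:R.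
    have := archi_boundP (divr_ge0 (mulr_ge0 (ltW C0) (normr_ge0 tau)) (ltW d0)).
    move=> h; exists (Num.bound (C * `|tau| / d)); apply: lt_le_trans h _.
    by rewrite ler_nat.
  have K0 : (0 : R) < K.+1%:R by rewrite ltr0n.
  have [h hK] : exists h, K.+1%:R * h = tau.
    by exists (tau / K.+1%:R); rewrite mulrC divfK // gt_eqF.
  have hKn : K.+1%:R * `|h| = `|tau| by rewrite -hK normrM normr_nat.
  have hd : C * `|h| < d.
    by rewrite -(ltr_pM2l K0) mulrCA hKn -ltr_pdivrMr.
  have poly j : (j <= K.+1)%N -> exists v, [/\ `|v - x| <= j%:R * (C * `|h|),
      v ord0 k = x ord0 k + j%:R * h
      & forall i, `|q i v - q i x| <= j%:R * (C1 * e * (C * `|h|))].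
    have inB j' v : (j' <= K.+1)%N -> `|v - x| <= j'%:R * (C * `|h|) -> B v.
      move=> jK vx; apply: le_trans xr'.
      have -> : v - v0 = (v - x) + (x - v0) by rewrite addrA subrK.
      rewrite (le_trans (ler_normD _ _)) // mulrDr mulr1 addrC lerD2l.
      apply: le_trans vx _; rewrite mulrCA [leRHS]mulrC ler_wpM2l ?(ltW C0) //.
      apply: le_trans tau_le; rewrite -hKn ler_wpM2r //.
      by rewrite ler_nat.
    elim: j => [_|j IH jK].
      exists x; rewrite subrr normr0 !mul0r addr0; split=> // i.
      by rewrite subrr normr0.
    have [v [vx vk vq]] := IH (ltnW jK).
    have Bv : B v := inB _ _ (ltnW jK) vx.
    have [N [rho [NC Nk DN]]] := HN v Bv.
    have hN : `|h *: N| <= C * `|h| by rewrite normrZ mulrC ler_wpM2r.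
    have vx' : `|v + h *: N - x| <= j.+1%:R * (C * `|h|).
      rewrite addrAC (le_trans (ler_normD _ _)) //.
      by rewrite -[j.+1]addn1 natrD mulrDl mul1r lerD.
    exists (v + h *: N); split => //.
      by rewrite !mxE vk Nk mulr1 -[j.+1]addn1 natrD mulrDl mul1r addrA.
    move=> i; have -> : q i (v + h *: N) - q i x =
        (q i (v + h *: N) - q i v) + (q i v - q i x) by rewrite addrA subrK.
    rewrite (le_trans (ler_normD _ _)) // addrC -[j.+1]addn1 natrD mulrDl mul1r.
    apply: lerD; first exact: vq.
    have := dstep v (h *: N) i (h * rho) Bv (inB _ _ jK vx') (le_lt_trans hN hd).
    move=> st; apply: le_trans (st _) _.
      move=> i'; have ud := @u_diff i' v Bv.
      by rewrite deriveE // linearZ -deriveE // DN -mulrA.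
    by rewrite ler_wpM2l // mulr_ge0 // ltW.
  have [v [vx vk vq]] := poly K.+1 (leqnn _).
  exists v; split.
  - apply: le_trans xr'; have -> : v - v0 = (v - x) + (x - v0) by rewrite addrA subrK.
    rewrite (le_trans (ler_normD _ _)) // mulrDr mulr1 addrC lerD2l.
    apply: le_trans vx _; rewrite mulrCA hKn mulrC ler_wpM2r // ltW //.
  - by rewrite vk hK /tau addrC subrK.
  - by move=> i; apply: le_trans (vq i) _; rewrite mulrCA [X in _ * X]mulrCA hKn.
pose S := B `&` [set v : 'rV[R]_n | v ord0 k = v0 ord0 k].
have cS : compact S.
  apply: (@subclosed_compact _ _ B); [|exact: closed_ballE_compact|by move=> ? []].
  apply: closedI; first exact: B_closed.
  rewrite -[X in closed X]/((fun v : 'rV[R]_n => v ord0 k) @^-1` [set v0 ord0 k]).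
  apply: closed_comp; last first.
    exact/accessible_closed_set1/hausdorff_accessible/norm_hausdorff.
  by move=> v _; exact: coord_continuous.
(* [F] measures how far the projective point at [v] is from the one at [x]. It attains its minimum
   on the compact slice, and [approx] forces that minimum to be zero. *)
pose F v := \sum_i `|q i v - q i x|.
have [|||s /[!inE] Ss smin] := @EVT_min_rV R n F S.
- by exists v0; split.
- by [].
- apply: continuous_in_subspaceT => v /[!inE] -[Bv _].
  have -> : F = \sum_i (fun v => `|q i v - q i x|).
    by apply/funext => w; rewrite fct_sumE.
  elim/big_ind : _ => [|f1 f2 c1 c2|i _].
  - exact: cst_continuous.
  - exact: continuousD.
  - have cu := @u_cont i v Bv; have cu0 := @u_cont i0 v Bv.
    exact: (cvg_norm (cvgB (cvgM cu (cvgV (u_neq0 Bv) cu0)) (cvg_cst (q i x)))).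
have Fge0 v : 0 <= F v by apply: sumr_ge0.
have Fs0 : F s <= 0.
  rewrite leNgt; apply/negP => Fs.
  (* Chosen so that [approx] with [e = F s / m] yields a total deviation strictly below [F s],
     against minimality; the [+ 1] gives both the strictness and [m > 0]. *)
  pose m := #|I|%:R * (C1 * (C * `|tau|)) + 1.
  have m0 : 0 < m by rewrite ltr_wpDl // !mulr_ge0 // ltW.
  have [v [Bv vk vq]] := approx (F s / m) (divr_gt0 Fs m0).
  have : F s < F s; last by rewrite ltxx.
  apply: le_lt_trans (smin v _) _; first by rewrite inE.
  apply: (@le_lt_trans _ _ (\sum_(i : I) C1 * (F s / m) * (C * `|tau|))).
    by apply: ler_sum => i _; exact: vq.
  rewrite sumr_const -mulr_natl.
  have -> : #|I|%:R * (C1 * (F s / m) * (C * `|tau|)) =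
      F s * (#|I|%:R * (C1 * (C * `|tau|)) / m) by field; rewrite gt_eqF.
  by rewrite gtr_pMr // ltr_pdivrMr // mul1r /m ltrDl.
have qsx i : q i s = q i x.
  apply/eqP; rewrite -subr_eq0 -normr_eq0 eq_le normr_ge0 andbT.
  apply: le_trans Fs0; rewrite /F (bigD1 i) //= lerDl.
  exact: sumr_ge0.
have [Bs sk] := Ss; exists s; split=> //.
have us := u_neq0 Bs; have ux := u_neq0 Bx.
exists (u i0 x / u i0 s); first by rewrite mulf_neq0 ?invr_eq0.
move=> i; have := qsx i; rewrite /q => e.
by rewrite -mulrA [_^-1 * _]mulrC e mulrC divfK.
Qed.

End euler.

(** * The null direction of a lightlike hypersurface *)

Section bilinear_form.
Context {R : realType} {m : nat} (G : 'M[R]_m).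
Implicit Types x y : 'rV[R]_m.

Definition bform x y : R := (x *m G *m y^T) ord0 ord0.

Lemma bformE x y : bform x y = \sum_i \sum_j x ord0 i * y ord0 j * G i j.
Proof.
rewrite /bform mxE exchange_big /=; apply: eq_bigr => j _.
rewrite !mxE mulr_suml; apply: eq_bigr => i _.
by rewrite mulrAC.
Qed.

Lemma bformDl x1 x2 y : bform (x1 + x2) y = bform x1 y + bform x2 y.
Proof. by rewrite /bform !mulmxDl mxE. Qed.

Lemma bformZl c x y : bform (c *: x) y = c * bform x y.
Proof. by rewrite /bform -!scalemxAl mxE. Qed.

Lemma bformDr x y1 y2 : bform x (y1 + y2) = bform x y1 + bform x y2.
Proof. by rewrite /bform linearD /= mulmxDr mxE. Qed.

Lemma bformZr c x y : bform x (c *: y) = c * bform x y.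
Proof. by rewrite /bform linearZ /= -scalemxAr mxE. Qed.

Lemma bformC x y : G^T = G -> bform x y = bform y x.
Proof.
move=> Gsym; rewrite !bformE exchange_big /=; apply: eq_bigr => j _.
by apply: eq_bigr => i _; rewrite (mulrC (x _ _)) -{1}Gsym mxE.
Qed.

Lemma is_derive_bform (V : normedModType R) (f g : V -> 'rV[R]_m) (x w : V) :
  differentiable f x -> differentiable g x ->
  is_derive x w (fun y : V => bform (f y) (g y))
    (bform ('D_w f x) (g x) + bform (f x) ('D_w g x)).
Proof.
move=> fd gd.
have -> : (fun y : V => bform (f y) (g y)) =
    \sum_i \sum_j (fun y : V => f y ord0 i * g y ord0 j * G i j).
  apply/funext => y; rewrite bformE fct_sumE; apply: eq_bigr => i _.
  by rewrite fct_sumE.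
rewrite !bformE -big_split /=; apply: is_derive_sum => i.
rewrite -big_split /=; apply: is_derive_sum => j.
have entry (F : V -> 'rV[R]_m) k : differentiable F x ->
    is_derive x w (fun y : V => F y ord0 k) (('D_w F x) ord0 k).
  move=> Fd; rewrite -derive_entry //.
  exact/derivableP/diff_derivable/differentiable_entry.
have fi := entry f i fd; have gj := entry g j gd.
have cst := is_derive_cst (G i j : R) x w.
apply: is_derive_eq (is_deriveM (is_deriveM fi gj) cst) _.
rewrite scaler0 add0r /= /GRing.scale /=; ring.
Qed.

Lemma derive_bform (V : normedModType R) (f g : V -> 'rV[R]_m) (x w : V) :
  differentiable f x -> differentiable g x ->
  'D_w (fun y : V => bform (f y) (g y)) x =
    bform ('D_w f x) (g x) + bform (f x) ('D_w g x).
Proof. by move=> fd gd; have [_] := is_derive_bform w fd gd. Qed.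

Lemma derive_qform a y : G^T = G -> 'D_y (qform G) a = 2 * bform y a.
Proof.
move=> Gsym; have -> : qform G = fun x => bform (id x) (id x) by [].
have idd : differentiable (id : 'rV[R]_m -> _) a by exact: ex_diff.
by rewrite derive_bform // derive_id (bformC a) // mulr2n mulrDl mul1r.
Qed.

(** A linear form vanishing on the kernel of another is a multiple of it; nondegeneracy of [G]
    carries this from the forms back to the vectors [p] and [c]. *)
Lemma bform_ker_proportional p c : G \in unitmx ->
  (forall y, bform y p = 0 -> bform y c = 0) -> exists mu, c = mu *: p.
Proof.
move=> Gu pc.
have tr (z : 'rV[R]_m) : z = (invmx G *m (G *m z^T))^T by rewrite mulKmx // trmxK.
have key (p' c' : 'cV[R]_m) :
    (forall y : 'rV[R]_m, y *m p' = 0 -> y *m c' = 0) -> exists mu, c' = mu *: p'.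
  move=> h; have [p0|] := eqVneq p' 0.
    exists 0; rewrite scale0r; apply/colP => i.
    have /h/matrixP/(_ ord0 ord0) : (delta_mx ord0 i : 'rV[R]_m) *m p' = 0.
      by rewrite p0 mulmx0.
    by rewrite -rowE !mxE.
  move=> /cV0Pn[j pj].
  exists (c' j ord0 / p' j ord0); apply/colP => k; rewrite mxE.
  (* These test vectors, combinations of two basis vectors, lie in the kernel of [p']; evaluating
     [c'] on them compares its entries [k] and [j]. *)
  have /matrixP/(_ ord0 ord0) : 
      (p' k ord0 *: delta_mx ord0 j - p' j ord0 *: delta_mx ord0 k : 'rV[R]_m) *m c' = 0.
    apply: h; apply/matrixP => i i'; rewrite !ord1 mulmxBl -!scalemxAl -!rowE !mxE.
    by rewrite mulrC subrr.
  rewrite mulmxBl -!scalemxAl -!rowE !mxE => /eqP; rewrite subr_eq0 => /eqP e.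
  by rewrite mulrAC [c' _ _ * _]mulrC e mulrAC divff // mul1r.
have [y|mu e] := key (G *m p^T) (G *m c^T).
  move=> yp; have := pc y; rewrite /bform -!mulmxA yp mxE => /(_ erefl) e.
  by apply/matrixP => i i'; rewrite !ord1 e mxE.
exists mu; rewrite (tr c) e -scalemxAr linearZ /=; congr (_ *: _).
by rewrite -tr.
Qed.

End bilinear_form.

Lemma signature_unitmx (R : realType) m p q (G : 'M[R]_m) :
  has_signature p q G -> G \in unitmx.
Proof.
move=> [_ _ [P Pu]] /(congr1 determinant); rewrite !det_mulmx det_tr det_diag => e.
rewrite unitmxE unitfE; apply/eqP => G0.
move: e; rewrite G0 mulr0 mul0r => /esym/eqP; rewrite prodf_seq_eq0 => /hasP[j _].
by rewrite mxE; case: ifP => _; rewrite ?oppr_eq0 oner_eq0.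
Qed.

Lemma derive_comm_rV (R : realType) (V : normedModType R) m
    (f : V -> 'rV[R]_m) (D : set V) (x v w : V) :
  open D -> D x -> smooth_on D f -> 'D_w ('D_v f) x = 'D_v ('D_w f) x.
Proof.
move=> oD Dx fs; apply/rowP => j.
have dE v1 v2 : ('D_v1 ('D_v2 f) x) ord0 j =
    'D_v1 ('D_v2 (fun y => f y ord0 j)) x.
  have vd := smooth_differentiable (smooth_derive v2 fs) Dx.
  rewrite -(derive_entry ord0 j v1 vd).
  apply: near_eq_derive; apply: (near_open oD Dx) => y Dy.
  by rewrite derive_entry //; exact: smooth_differentiable fs Dy.
have f2 : Ck_on 2 D (fun y => f y ord0 j) by apply: Ck_entry => //; exact: fs.
exact: etrans (dE w v) (etrans (derive_comm v w oD Dx f2) (esym (dE v w))).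
Qed.

(** * Pluecker coordinates of planes *)

Section plucker.
Context {R : realType} {m : nat}.
Implicit Types a b : 'rV[R]_m.

Definition plucker a b (ij : 'I_m * 'I_m) : R :=
  a ord0 ij.1 * b ord0 ij.2 - b ord0 ij.1 * a ord0 ij.2.

(** The vectors [a_i b - b_i a] are contractions of the bivector of [a] and [b], so they depend only
    on its Pluecker coordinates and also lie in the span of [a'] and [b']. Combining those for [k]
    and [l] gives [a] and [b], multiplied by the nonzero coordinate. *)
Lemma plucker_sub a b a' b' c ij : plucker a b ij != 0 ->
  (forall kl, plucker a b kl = c * plucker a' b' kl) ->
  (<[a]> + <[b]> <= <[a']> + <[b']>)%VS.
Proof.
case: ij => k l; rewrite /plucker /= => kl0 pc; set W := (<[a']> + _)%VS.
have inW i : a ord0 i *: b - b ord0 i *: a \in W.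
  have -> : a ord0 i *: b - b ord0 i *: a =
      (c * a' ord0 i) *: b' - (c * b' ord0 i) *: a'.
    by apply/rowP => j; have := pc (i, j); rewrite !mxE /= => ->; ring.
  apply: rpredB; apply: rpredZ.
    by rewrite /W (subvP (addvSr _ _)) // memv_line.
  by rewrite /W (subvP (addvSl _ _)) // memv_line.
have cancel z : (a ord0 k * b ord0 l - b ord0 k * a ord0 l) *: z \in W -> z \in W.
  by move=> zW; rewrite -[z](scalerK kl0) rpredZ.
have comb x y : x *: (a ord0 k *: b - b ord0 k *: a) -
    y *: (a ord0 l *: b - b ord0 l *: a) \in W by rewrite rpredB // rpredZ.
rewrite subv_add -!memvE; apply/andP; split; apply: cancel.
- have := comb (a ord0 l) (a ord0 k); congr (_ \in W).
  by apply/rowP => j; rewrite !mxE; ring.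
- have := comb (b ord0 l) (b ord0 k); congr (_ \in W).
  by apply/rowP => j; rewrite !mxE; ring.
Qed.

Lemma plucker_eq a b a' b' c ij ij' : c != 0 ->
  plucker a b ij != 0 -> plucker a' b' ij' != 0 ->
  (forall kl, plucker a b kl = c * plucker a' b' kl) ->
  (<[a]> + <[b]> = <[a']> + <[b']>)%VS.
Proof.
move=> c0 p0 p0' pc; apply/eqP; rewrite eqEsubv (plucker_sub p0 pc).
by apply: (plucker_sub (c := c^-1) p0') => kl; rewrite pc mulKf.
Qed.

Lemma plucker_exists a b : (forall c, a != c *: b) -> b != 0 ->
  exists ij, plucker a b ij != 0.
Proof.
move=> ab /rV0Pn[j bj].
have : a != (a ord0 j / b ord0 j) *: b by [].
move=> /eqP/rowP ne; apply: contrapT => /forallNP p0; apply: ne => i.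
have := p0 (i, j) => /negP/negPn; rewrite /plucker /= subr_eq0 => /eqP e.
by rewrite mxE mulrAC [a _ j * _]mulrC -e mulfK.
Qed.

End plucker.

(** * Moving frame of the tangent hyperplane, its pole and the null direction *)

Section frame.
Context {R : realType} {n : nat} (G : 'M[R]_n.+2) (h : 'rV[R]_n -> 'rV[R]_n.+2).
Implicit Types (v : 'rV[R]_n) (y : 'rV[R]_n.+2).

Definition frame v : 'M[R]_(1 + n, n.+2) :=
  col_mx (h v) (\matrix_(k < n) 'D_(delta_mx ord0 k) h v).

Definition ext_frame y v : 'M[R]_n.+2 := col_mx y (frame v).

(* The coefficients of the linear form [y |-> \det (ext_frame y v)], whose kernel
   is the tangent hyperplane. *)
Definition conormal v : 'rV[R]_n.+2 := \row_j cofactor (ext_frame 0 v) ord0 j.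

(** The pole of the tangent hyperplane with respect to the absolute. Being polynomial in [h] and its
    first derivatives, it represents the point of contact smoothly. *)
Definition polar v : 'rV[R]_n.+2 := conormal v *m invmx G.

Lemma det_ext_frame y v : \det (ext_frame y v) = (y *m (conormal v)^T) ord0 ord0.
Proof.
rewrite (expand_det_row _ ord0) !mxE; apply: eq_bigr => j _; rewrite !mxE; congr (_ * _).
  by case: splitP => // k _; rewrite ord1.
(* Cofactors along the first row do not see that row, so the [0] in [conormal] can stand for any
   [y]. *)
congr (_ * \det _); apply/matrixP => i k; rewrite !mxE.
by case: splitP => // i'; rewrite ord1.
Qed.

Lemma bform_polar y v : G^T = G -> G \in unitmx ->
  bform G y (polar v) = \det (ext_frame y v).
Proof.
move=> Gsym Gu; rewrite det_ext_frame /bform /polar trmx_mul trmx_inv Gsym.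
by rewrite -mulmxA mulKVmx.
Qed.

Lemma det_ext_frame_eq0 y v : row_free (frame v) ->
  (\det (ext_frame y v) == 0) = (y <= frame v)%MS.
Proof.
move=> hf; apply/idP/idP => [/det0P[u u0]|/submxP[z ->]].
  pose a := @lsubmx _ 1 1 (1 + n) u; pose b := @rsubmx _ 1 1 (1 + n) u.
  have ab : row_mx a b = u by exact: hsubmxK.
  move=> ue; have : a *m y + b *m frame v = 0 by rewrite -mul_row_col ab.
  move/eqP; rewrite addr_eq0 => /eqP e.
  have {u0} : row_mx a b != 0 by rewrite ab.
  clearbody a b; clear u ab ue.
  have [a0|a0] := eqVneq (a ord0 ord0) 0.
    have a0' : a = 0 by apply/matrixP => i j; rewrite !ord1 a0 mxE.
    move: e; rewrite a0' mul0mx => /esym/eqP; rewrite oppr_eq0.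
    rewrite mulmx_free_eq0 // => /eqP ->.
    by rewrite row_mx0 eqxx.
  move=> _; have -> : y = - (a ord0 ord0)^-1 *: b *m frame v.
    rewrite -scalemxAl scaleNr -scalerN -e [a]mx11_scalar mul_scalar_mx scalerA.
    by rewrite !mxE /= mulr1n mulVf // scale1r.
  exact: submxMl.
apply/det0P; exists (row_mx (1%:M : 'M[R]_1) (- z)).
  apply/eqP => e; have := congr1 (@lsubmx _ 1 1 (1 + n)) e.
  by rewrite row_mxKl => /matrixP/(_ ord0 ord0)/eqP; rewrite !mxE /= oner_eq0.
rewrite -[LHS]/(row_mx (1%:M : 'M[R]_1) (- z) *m col_mx (z *m frame v) (frame v)).
by rewrite mul_row_col mul1mx mulNmx subrr.
Qed.

(** Otherwise every vector would lie in the row space of [frame h v], which has only [n + 1] rows in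
    a space of dimension [n + 2]. *)
Lemma conormal_neq0 v : row_free (frame v) -> conormal v != 0.
Proof.
move=> hf; apply/eqP => c0.
have sub : (1%:M <= frame v)%MS.
  apply/row_subP => i; rewrite -det_ext_frame_eq0 // det_ext_frame c0.
  by rewrite trmx0 mulmx0 mxE.
have := mxrankS sub; rewrite mxrank1 => /leq_trans/(_ (rank_leq_row _)).
by rewrite ltnn.
Qed.

Lemma polar_neq0 v : G \in unitmx -> row_free (frame v) -> polar v != 0.
Proof.
move=> Gu hf; apply: contraNneq (conormal_neq0 hf) => a0.
by rewrite -[conormal v](mulmxKV Gu) -/(polar v) a0 mul0mx.
Qed.

Lemma bform_polar_eq0 y v : G^T = G -> G \in unitmx -> row_free (frame v) ->
  (bform G y (polar v) == 0) = (y <= frame v)%MS.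
Proof. by move=> Gsym Gu hf; rewrite bform_polar // det_ext_frame_eq0. Qed.

Lemma h_sub_frame v : (h v <= frame v)%MS.
Proof. by rewrite /frame -addsmxE addsmxSl. Qed.

Lemma mulmx_frame (u : 'rV[R]_n) v : differentiable h v ->
  u *m (\matrix_(k < n) 'D_(delta_mx ord0 k) h v) = 'D_u h v.
Proof.
move=> hd; rewrite deriveE // {2}[u]row_sum_delta linear_sum mulmx_sum_row.
by apply: eq_bigr => k _; rewrite rowK linearZ -deriveE.
Qed.

Lemma derive_sub_frame v w : differentiable h v -> ('D_w h v <= frame v)%MS.
Proof.
move=> hd; rewrite -mulmx_frame //.
by apply: submx_trans (submxMl _ _) _; rewrite /frame -addsmxE addsmxSr.
Qed.

Variables (D : set 'rV[R]_n).
Hypothesis oD : open D.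
Hypothesis h_smooth : smooth_on D h.

Lemma smooth_frame i j : smooth_on D (fun v => frame v i j).
Proof.
move=> k; case: (split_ordP i) => i' ->.
  have -> : (fun v => frame v (lshift n i') j) = (fun v => h v ord0 j).
    by apply/funext => v; rewrite col_mxEu ord1.
  by apply: Ck_entry => //; exact: h_smooth.
have -> : (fun v => frame v (rshift 1 i') j) =
    (fun v => 'D_(delta_mx ord0 i') h v ord0 j).
  by apply/funext => v; rewrite col_mxEd mxE.
by apply: Ck_entry => //; exact: smooth_derive.
Qed.

Lemma smooth_ext_frame y (i : 'I_(1 + (1 + n))) j :
  smooth_on D (fun v => ext_frame y v i j).
Proof.
move=> k; case: (split_ordP i) => i' ->.
  have -> : (fun v => ext_frame y v (lshift (1 + n) i') j) = (fun=> y ord0 j).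
    apply/funext => v; rewrite -[LHS]/(col_mx y (frame v) (lshift (1 + n) i') j).
    by rewrite col_mxEu ord1.
  exact: Ck_cst.
have -> : (fun v => ext_frame y v (rshift 1 i') j) = (fun v => frame v i' j).
  apply/funext => v; rewrite -[LHS]/(col_mx y (frame v) (rshift 1 i') j).
  by rewrite col_mxEd.
exact: smooth_frame.
Qed.

Lemma smooth_cofactor y i j :
  smooth_on D (fun v => cofactor (ext_frame y v) i j).
Proof.
move=> k; apply: Ck_mul => //; first exact: Ck_cst.
apply: Ck_det => // i' j'.
have -> : (fun v => row' i (col' j (ext_frame y v)) i' j') =
    (fun v => ext_frame y v (lift i i') (lift j j')).
  by apply/funext => v; rewrite !mxE.
exact: smooth_ext_frame.
Qed.

Lemma smooth_conormal : smooth_on D conormal.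
Proof.
move=> k; apply: Ck_row => // j.
have -> : (fun v => conormal v ord0 j) = (fun v => cofactor (ext_frame 0 v) ord0 j).
  by apply/funext => v; rewrite mxE.
exact: smooth_cofactor.
Qed.

Lemma smooth_polar : smooth_on D polar.
Proof.
apply: smooth_mulmx => //; first exact: smooth_conormal.
by move=> i j k; exact: Ck_cst.
Qed.

(* By Cramer's rule, the coordinates of [\det (ext_frame y v) *: polar v] in the
   rows of [ext_frame y v]: the determinant is kept to avoid a division. *)
Definition null_coords y v : 'rV[R]_n.+2 := polar v *m \adj (ext_frame y v).

(** The first two entries of [null_coords], the coefficients of [y] and of [h v], are cut off; what
    remains are the coefficients of the partial derivatives of [h], that is, a direction in the
    chart. *)
Definition null_dir y v : 'rV[R]_n :=
  @rsubmx _ 1 1 n (@rsubmx _ 1 1 (1 + n) (null_coords y v)).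

Lemma smooth_null_coords y : smooth_on D (null_coords y).
Proof.
apply: smooth_mulmx => //; first exact: smooth_polar.
move=> i j; have -> : (fun v => (\adj (ext_frame y v)) i j) =
    (fun v => cofactor (ext_frame y v) j i).
  by apply/funext => v; rewrite mxE.
exact: smooth_cofactor.
Qed.

Lemma smooth_null_dir y : smooth_on D (null_dir y).
Proof.
move=> k; apply: Ck_row => // j.
have -> : (fun v => null_dir y v ord0 j) =
    (fun v => null_coords y v ord0 (rshift 1 (rshift 1 j))).
  by apply/funext => v; rewrite !mxE.
by apply: Ck_entry => //; exact: smooth_null_coords.
Qed.

End frame.

(** * Constancy of the generator along the null direction *)

Section lightlike_frame.
Context {R : realType} {n : nat} (G : 'M[R]_n.+2) (h : 'rV[R]_n -> 'rV[R]_n.+2).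
Variable D : set 'rV[R]_n.
Implicit Types (v : 'rV[R]_n) (y : 'rV[R]_n.+2).
Local Notation B := (bform G).
Local Notation a := (polar G h).

Hypothesis Gsym : G^T = G.
Hypothesis Gunit : G \in unitmx.
Hypothesis oD : open D.
Hypothesis h_smooth : smooth_on D h.
Hypothesis h_free : forall v, D v -> row_free (frame h v).
Hypothesis h_pos : forall v, D v -> 0 < B (h v) (h v).
Hypothesis h_null : forall v, D v -> B (a v) (a v) = 0.

Let hd v : D v -> differentiable h v.
Proof. exact: smooth_differentiable h_smooth. Qed.

Let ad v : D v -> differentiable a v.
Proof. exact: smooth_differentiable (smooth_polar G oD h_smooth). Qed.

Let perp v y : D v -> B y (a v) = 0 -> (y <= frame h v)%MS.
Proof. by move=> Dv /eqP; rewrite bform_polar_eq0 //; exact: h_free. Qed.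

Let tangent v y : D v -> (y <= frame h v)%MS -> B y (a v) = 0.
Proof. by move=> Dv yT; apply/eqP; rewrite bform_polar_eq0 //; exact: h_free. Qed.

Let Dh_a v w : D v -> B ('D_w h v) (a v) = 0.
Proof. by move=> Dv; apply: tangent => //; exact/derive_sub_frame/hd. Qed.

Let h_a v : D v -> B (h v) (a v) = 0.
Proof. by move=> Dv; apply: tangent => //; exact: h_sub_frame. Qed.

Let h_Da v w : D v -> B (h v) ('D_w a v) = 0.
Proof.
move=> Dv; have := derive_zero_on w oD Dv h_a.
by rewrite derive_bform ?Dh_a ?add0r //; [exact: hd|exact: ad].
Qed.

Let a_Da v w : D v -> B (a v) ('D_w a v) = 0.
Proof.
move=> Dv; have := derive_zero_on w oD Dv h_null.
rewrite derive_bform; try exact: ad.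
rewrite (bformC _ (a v)) // -mulr2n => /eqP.
by rewrite mulrn_eq0 => /eqP; rewrite bformC.
Qed.

Lemma null_dirE y v : D v -> \det (ext_frame h y v) != 0 ->
  exists c, 'D_(null_dir G h y v) h v = \det (ext_frame h y v) *: a v - c *: h v.
Proof.
move=> Dv dE.
pose nu := null_coords G h y v.
pose nu0 := @lsubmx _ 1 1 (1 + n) nu.
pose nu1 := @lsubmx _ 1 1 n (@rsubmx _ 1 1 (1 + n) nu).
have nuE : row_mx nu0 (row_mx nu1 (null_dir G h y v)) = nu.
  rewrite /null_dir -/nu -/nu0 /nu1 [X in row_mx _ X]hsubmxK; exact: hsubmxK.
have nuM : nu *m ext_frame h y v = \det (ext_frame h y v) *: a v.
  by rewrite /nu /null_coords -mulmxA mul_adj_mx mul_mx_scalar.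
have e : \det (ext_frame h y v) *: a v =
    nu0 ord0 ord0 *: y + (nu1 ord0 ord0 *: h v + 'D_(null_dir G h y v) h v).
  rewrite -nuM -nuE.
  rewrite -[LHS]/(row_mx nu0 (row_mx nu1 (null_dir G h y v)) *m col_mx y (frame h v)).
  rewrite mul_row_col [X in _ + X]mul_row_col (mulmx_frame _ (hd Dv)).
  by rewrite {1}[nu0]mx11_scalar {1}[nu1]mx11_scalar !mul_scalar_mx.
(* Pairing with [a v] kills every term except that of [y]: [a v] is null and orthogonal to the whole
   frame, while its product with [y] is the nonzero determinant. *)
have nu00 : nu0 ord0 ord0 = 0.
  have := congr1 (fun z => B z (a v)) e.
  rewrite !(bformDl, bformZl) h_null // h_a // Dh_a // !mulr0 !addr0.
  rewrite bform_polar // => /esym/eqP; rewrite mulf_eq0 (negbTE dE) orbF.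
  by move/eqP.
exists (nu1 ord0 ord0); rewrite e nu00 scale0r add0r addrC addKr //.
Qed.

(** ['D_N a] is orthogonal to the whole tangent hyperplane, hence a multiple of its pole. On
    ['D_k h] this is the symmetry of the second fundamental form: [B('D_k h, 'D_N a) = - B('D_N 'D_k
    h, a) = - B('D_k 'D_N h, a) = B('D_N h, 'D_k a)], and the last term vanishes because ['D_N h] is
    a combination of [a] and [h], both orthogonal to ['D_k a]. *)
Lemma derive_polar_null y v : D v -> \det (ext_frame h y v) != 0 ->
  exists mu, 'D_(null_dir G h y v) a v = mu *: a v.
Proof.
move=> Dv dE; have [c NE] := null_dirE Dv dE.
set N := null_dir G h y v in NE *.
apply: (@bform_ker_proportional _ _ G) => // z /(perp Dv)/submxP[u ->].
have as_smooth := smooth_polar G oD h_smooth.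
have DkN k : B ('D_(delta_mx ord0 k) h v) ('D_N a v) = 0.
  (* Here [N] is frozen at its value at [v], so that the mixed second derivatives
     of [h] in [e1] and [e2] agree. *)
  have e1 := derive_zero_on N oD Dv (fun v' Dv' => @Dh_a v' (delta_mx ord0 k) Dv').
  have e2 := derive_zero_on (delta_mx ord0 k) oD Dv (fun v' Dv' => @Dh_a v' N Dv').
  have Dkd := smooth_differentiable (smooth_derive (delta_mx ord0 k) h_smooth) Dv.
  have DNd := smooth_differentiable (smooth_derive N h_smooth) Dv.
  rewrite (derive_bform _ _ Dkd (ad Dv)) in e1.
  rewrite (derive_bform _ _ DNd (ad Dv)) in e2.
  have e3 : B ('D_N h v) ('D_(delta_mx ord0 k) a v) = 0.
    rewrite NE bformDl -scaleNr !bformZl h_Da // a_Da //.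
    by rewrite !mulr0 addr0.
  rewrite e3 addr0 (derive_comm_rV _ _ oD Dv h_smooth) in e2.
  by rewrite e2 add0r in e1.
rewrite -[u](@hsubmxK _ 1 1 n) mul_row_col bformDl.
rewrite [lsubmx u]mx11_scalar mul_scalar_mx bformZl h_Da // mulr0 add0r.
rewrite mulmx_sum_row /bform -(mulmxA _ G) mulmx_suml summxE big1 // => k _.
by rewrite rowK -scalemxAl mulmxA mxE -/(bform G _ _) DkN mulr0.
Qed.

Lemma generator_indep v c : D v -> h v != c *: a v.
Proof.
move=> Dv; apply/eqP => e; have := h_pos Dv.
by rewrite {1}e bformZl bformC // h_a // mulr0 ltxx.
Qed.

Lemma smooth_plucker ij : smooth_on D (fun v => plucker (h v) (a v) ij).
Proof.
have as_ := smooth_polar G oD h_smooth.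
move=> k; have entry (f : 'rV[R]_n -> 'rV[R]_n.+2) i :
    smooth_on D f -> Ck_on k D (fun v => f v ord0 i).
  by move=> fs; apply: Ck_entry => //; exact: fs.
apply: Ck_add => //; first by apply: Ck_mul => //; exact: entry.
have cm : Ck_on k D (fun _ : 'rV[R]_n => - 1 : R) by exact: Ck_cst.
have := Ck_mul oD cm (Ck_mul oD (entry _ ij.1 as_) (entry _ ij.2 h_smooth)).
by move=> H; apply: (Ck_on_ext oD H) => v _; rewrite mulN1r.
Qed.

Lemma derive_plucker_null y v : D v -> \det (ext_frame h y v) != 0 ->
  exists rho, forall ij, 'D_(null_dir G h y v) (fun v => plucker (h v) (a v) ij) v =
    rho * plucker (h v) (a v) ij.
Proof.
move=> Dv dE; have [c Nh] := null_dirE Dv dE.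
have [mu Na] := derive_polar_null Dv dE.
(* The [a] component of ['D_N h] drops out by antisymmetry; there remain the factor [- c] from [h]
   and [mu] from [a]. *)
set N := null_dir G h y v in Nh Na *; exists (mu - c) => -[i j].
have entry (f : 'rV[R]_n -> 'rV[R]_n.+2) k : differentiable f v ->
    is_derive v N (fun z => f z ord0 k) (('D_N f v) ord0 k).
  move=> fd; rewrite -derive_entry //.
  exact/derivableP/diff_derivable/differentiable_entry.
have d := is_deriveB (is_deriveM (entry _ i (hd Dv)) (entry _ j (ad Dv)))
                     (is_deriveM (entry _ i (ad Dv)) (entry _ j (hd Dv))).
case: d => _ dv; apply: (etrans dv).
rewrite Nh Na /plucker /= /GRing.scale /=.
move: (h v) (a v) (\det _) => h' a' e; rewrite !mxE; ring.
Qed.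

(** If it vanished, [null_dirE] would make [a v] a multiple of [h v], which is orthogonal to [a v]
    but not to itself. *)
Lemma null_dir_neq0 y v : D v -> \det (ext_frame h y v) != 0 ->
  null_dir G h y v != 0.
Proof.
move=> Dv dE; apply/eqP => N0.
have [c] := null_dirE Dv dE.
rewrite N0 derive0 => /esym/eqP; rewrite subr_eq0 => /eqP e.
have := polar_neq0 Gunit (h_free Dv).
have : B (h v) (c *: h v) = 0 by rewrite -e bformZr h_a // mulr0.
move/eqP; rewrite bformZr mulf_eq0 (gt_eqF (h_pos Dv)) orbF => /eqP c0.
by move/eqP: e; rewrite c0 scale0r scaler_eq0 (negbTE dE) /= => ->.
Qed.

Lemma generator_meets_slice v0 : D v0 -> exists k, exists2 r, 0 < r &
  forall x, `|x - v0| < r -> D x /\ exists s, [/\ D s, s ord0 k = v0 ord0 k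
    & (<[h x]> + <[a x]> = <[h s]> + <[a s]>)%VS].
Proof.
move=> Dv0.
have /rV0Pn[j0 cj0] := conormal_neq0 (h_free Dv0).
(* A basis vector outside the tangent hyperplane at [v0]; by continuity it stays outside the tangent
   hyperplanes at nearby points. *)
pose y : 'rV[R]_n.+2 := delta_mx ord0 j0.
have dE0 : \det (ext_frame h y v0) != 0.
  by rewrite det_ext_frame /y -rowE mxE mxE.
have [ij p0] := plucker_exists (fun c => generator_indep c Dv0)
  (polar_neq0 Gunit (h_free Dv0)).
(* The coordinate [k] is one that varies along [N], so that its slices are transversal to [N]. *)
have /rV0Pn[k Nk] := null_dir_neq0 Dv0 dE0.
set N := null_dir G h y in Nk.
have Ns : smooth_on D N by exact: smooth_null_dir.
have c1 : \forall v \near v0, D v by exact: open_nbhs_nbhs.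
have c2 : \forall v \near v0, \det (ext_frame h y v) != 0.
  have ds : smooth_on D (fun v => \det (ext_frame h y v)).
    by move=> q; apply: Ck_det => // i j; exact: smooth_ext_frame.
  have dc := smooth_continuous ds Dv0.
  exact: cvgr_neq0 dc dE0.
have c3 : \forall v \near v0, plucker (h v) (a v) ij != 0.
  have dc := smooth_continuous (smooth_plucker ij) Dv0.
  exact: cvgr_neq0 dc p0.
have c4 : \forall v \near v0, `|N v0 ord0 k| / 2 < `|N v ord0 k|.
  have Nc : {for v0, continuous (fun v => N v ord0 k)}.
    by have Nk0 := Ck_entry ord0 k oD (Ns 0%N); exact: Nk0.
  apply: (cvgr_gt _ (cvg_norm Nc)).
  by rewrite ltr_pdivrMr // ltr_pMr ?normr_gt0 // ltr1n.
have c5 : \forall v \near v0, `|N v| < `|N v0| + 1.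
  apply: (cvgr_lt _ (cvg_norm (smooth_continuous Ns Dv0))).
  by rewrite ltrDl.
have : nbhs v0 [set v | D v /\ (\det (ext_frame h y v) != 0 /\
   (plucker (h v) (a v) ij != 0 /\ (`|N v0 ord0 k| / 2 < `|N v ord0 k| /\
   `|N v| < `|N v0| + 1)))].
  exact: filterI c1 (filterI c2 (filterI c3 (filterI c4 c5))).
move=> /nbhs_ballP[d /= d0]; rewrite -ball_normE => Hd.
pose r := d / 2.
have r0 : 0 < r by rewrite divr_gt0.
have inball v : `|v - v0| <= r -> ball_ Num.Def.normr v0 d v.
  move=> vr; rewrite /= distrC; apply: le_lt_trans vr _.
  by rewrite ltr_pdivrMr // ltr_pMr // ltr1n.
pose u (ij : 'I_n.+2 * 'I_n.+2) v := plucker (h v) (a v) ij.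
(* Bounds the direction [N v] divided by its [k]-th entry, by the upper bound [c5] for the norm and
   the lower bound [c4] for the entry. *)
pose C := (`|N v0| + 1) / (`|N v0 ord0 k| / 2).
have Nk2 : 0 < `|N v0 ord0 k| / 2 by rewrite divr_gt0 ?normr_gt0.
have C0 : 0 < C by rewrite divr_gt0 // ltr_wpDl.
have [||||r' r'0 Hr'] := @polygon_meets_slice R n _ u ij v0 r r0 _ _ _ k C C0.
- move=> kl v /inball/Hd[Dv _]; exact: smooth_differentiable (smooth_plucker kl) Dv.
- move=> kl l v /inball/Hd[Dv _].
  exact: smooth_continuous (smooth_derive _ (smooth_plucker kl)) Dv.
- by move=> v /inball/Hd[_ [_ [pl _]]].
- move=> v /inball/Hd[Dv [dE [_ [Nkv Nv]]]].
  have [rho Du] := derive_plucker_null Dv dE.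
  have Nkv0 : N v ord0 k != 0 by rewrite -normr_gt0 (lt_trans Nk2).
  exists ((N v ord0 k)^-1 *: N v), ((N v ord0 k)^-1 * rho); split.
  + rewrite normrZ normfV /C mulrC ler_pM ?invr_ge0 //; first exact: ltW.
    by rewrite lef_pV2 ?posrE ?normr_gt0 // ltW.
  + by rewrite mxE mulVf.
  + move=> kl; have ud := smooth_differentiable (smooth_plucker kl) Dv.
    by rewrite deriveE // linearZ -deriveE // Du -mulrA.
exists k, r' => // x /Hr'[Bx [s [Bs sk [c c0 us]]]].
have [Dx [_ [px _]]] := Hd _ (inball _ Bx).
have [Ds [_ [ps _]]] := Hd _ (inball _ Bs).
split; [exact: Dx|exists s; split; [exact: Ds|exact: sk|]].
exact: (plucker_eq c0 px ps us).
Qed.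

End lightlike_frame.

(** * Generators *)

Section lifts.
Context {R : realType}.

Definition lift_tangent d N (h : 'rV[R]_d -> 'rV[R]_N.+1) v : {vspace 'rV[R]_N.+1} :=
  (<[h v]> + \sum_(k < d) <['D_(delta_mx ord0 k) h v]>)%VS.

Lemma mem_lift_tangent_derive d N (h : 'rV[R]_d -> 'rV[R]_N.+1) v w :
  differentiable h v -> 'D_w h v \in lift_tangent h v.
Proof.
move=> hd; rewrite deriveE // [w]row_sum_delta linear_sum rpred_sum // => k _.
rewrite linearZ rpredZ // -deriveE //; apply: (subvP (addvSr _ _)).
by apply: (subvP (sumv_sup k _ _)); rewrite ?memv_line //.
Qed.

(** Meant for [g] an old lift composed with a transition map and [h'] a new lift: a change of lift
    and of chart is treated at once. *)
Lemma lift_tangent_sub d N (g h' : 'rV[R]_d -> 'rV[R]_N.+1) (T : {vspace 'rV[R]_N.+1}) v :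
  differentiable g v -> differentiable h' v -> g v != 0 ->
  (\forall w \near v, <[h' w]>%VS = <[g w]>%VS) ->
  g v \in T -> (forall w, 'D_w g v \in T) -> (lift_tangent h' v <= T)%VS.
Proof.
move=> gd hd gv0 hg gT DgT.
have h'T : h' v \in T.
  have /vlineP[c ->] : h' v \in <[g v]>%VS.
    by rewrite -(nbhs_singleton hg) memv_line.
  by rewrite rpredZ.
have /rV0Pn[e ge] := gv0.
(* The proportionality [h' = c g] is cross-multiplied, as the differentiability of
   [c] is not known. *)
have prod j : \near v, g v ord0 e * h' v ord0 j = h' v ord0 e * g v ord0 j.
  apply: filterS hg => w hgw.
  have /vlineP[c ->] : h' w \in <[g w]>%VS by rewrite -hgw memv_line.
  by rewrite !mxE; ring.
have Dh'T w : 'D_w h' v \in T.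
  have comb : g v ord0 e *: 'D_w h' v = 'D_w (fun z => h' z ord0 e) v *: g v
      + h' v ord0 e *: 'D_w g v - 'D_w (fun z => g z ord0 e) v *: h' v.
    apply/rowP => j.
    have der (F F' : 'rV[R]_d -> R) : differentiable F v -> differentiable F' v ->
        'D_w (fun z => F z * F' z) v = F v * 'D_w F' v + F' v * 'D_w F v.
      by move=> Fd Fd'; apply: deriveM; exact: diff_derivable.
    have := near_eq_derive w (prod j).
    rewrite !der; try exact: differentiable_entry.
    rewrite !(derive_entry ord0 j w) // !mxE => e1.
    rewrite [X in _ = X + _ - _]mulrC.
    rewrite [X in _ = _ - X]mulrC [X in _ = X - _]addrC.
    by rewrite -e1 addrK.
  have := comb; move/(congr1 ( *:%R (g v ord0 e)^-1)); rewrite scalerK // => ->.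
  by rewrite rpredZ // rpredB ?rpredD // rpredZ.
rewrite /lift_tangent subv_add; apply/andP; split; first by rewrite -memvE.
by apply/subv_sumP => k _; rewrite -memvE.
Qed.

Lemma pline_gen_neq0 N (p : pspace R N) w : p = <[w]>%VS :> {vspace _} -> w != 0.
Proof.
by move=> pw; have := pline_dim p; rewrite pw dim_vline; case: (w != 0).
Qed.

Lemma pspace_eq N (p q : pspace R N) : pline p = pline q -> p = q.
Proof.
case: p q => [U dU] [W dW] /= e; move: dU; rewrite e => dU.
by rewrite (bool_irrelevance dU dW).
Qed.

Lemma vpick_neq0 N (p : pspace R N) : vpick p != 0.
Proof. by rewrite vpick0 -dimv_eq0 (eqP (pline_dim p)). Qed.

Lemma pline_vpick N (p : pspace R N) : pline p = <[vpick p]>%VS.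
Proof.
apply/esym/eqP; rewrite eqEdim -memvE memv_pick (eqP (pline_dim p)) dim_vline.
by rewrite vpick0 -dimv_eq0 (eqP (pline_dim p)).
Qed.

Section two_lifts.
Context {d N : nat} (X : manifold R d) (phi : X -> pspace R N).

Lemma chart_inv_img (i : chart X) w : (chart_map i @` chart_dom i) w ->
  chart_dom i (chart_inv i w) /\ chart_map i (chart_inv i w) = w.
Proof. by move=> [z dz <-]; rewrite chart_mapK. Qed.

Lemma lift_tangent_sub_lift x i D h i' D' h' :
  local_lift phi x i D h -> local_lift phi x i' D' h' ->
  (lift_tangent h' (chart_map i' x) <= lift_tangent h (chart_map i x))%VS.
Proof.
move=> [dx oD Dx hs hphi] [dx' oD' Dx' hs' hphi'].
set v := chart_map i x; set v' := chart_map i' x.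
pose psi := chart_map i \o chart_inv i'.
have psiv : psi v' = v by rewrite /psi /= /v' chart_mapK.
have Sv' : (chart_map i' @` (chart_dom i' `&` chart_dom i)) v' by exists x.
have psi_s := @chart_transition _ _ X i' i.
have psid := smooth_differentiable psi_s Sv'.
have hd : differentiable h (psi v') by rewrite psiv; exact: smooth_differentiable hs Dx.
have gd : differentiable (h \o psi) v' by exact: differentiable_comp.
have near_lines : \forall w \near v', <[h' w]>%VS = <[(h \o psi) w]>%VS.
  have c1 : \forall w \near v', D' w by exact: open_nbhs_nbhs.
  have c2 : \forall w \near v', (chart_map i' @` chart_dom i') w.
    by apply: open_nbhs_nbhs; split; [exact: chart_img_open|exists x].
  have c3 : \forall w \near v', chart_dom i (chart_inv i' w).
    have cinv : {for v', continuous (chart_inv i')}.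
      by apply: chart_inv_continuous; exists x.
    apply: cinv; rewrite /v' chart_mapK //.
    by apply: open_nbhs_nbhs; split => //; exact: chart_dom_open.
  have c4 : \forall w \near v', D (psi w).
    have cpsi := differentiable_continuous psid.
    apply: cpsi; rewrite -/psi psiv; exact: open_nbhs_nbhs.
  apply: filterS (filterI (filterI c1 c2) (filterI c3 c4)) => w.
  move=> [[D'w iw] [diw Dpw]].
  have [diw' cw] := chart_inv_img iw.
  have := hphi _ diw Dpw; have := hphi' _ diw'; rewrite cw => /(_ D'w) -> e.
  exact: e.
apply: (lift_tangent_sub gd (smooth_differentiable hs' Dx') _ near_lines).
- by rewrite /= -/psi psiv; exact: pline_gen_neq0 (hphi x dx Dx).
- by rewrite /= psiv; apply: (subvP (addvSl _ _)); exact: memv_line.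
- move=> w; rewrite (deriveE w gd) (diff_comp psid hd).
  rewrite -[X in X \in _]/('d h (psi v') ('d psi v' w)) -(deriveE _ hd) psiv.
  apply: mem_lift_tangent_derive; exact: smooth_differentiable hs Dx.
Qed.

End two_lifts.

End lifts.

(** * The tangent hyperplane as row space of the frame *)

Section frames.
Context {R : realType} {n : nat}.
Variable h : 'rV[R]_n -> 'rV[R]_n.+2.
Implicit Types (v : 'rV[R]_n) (y : 'rV[R]_n.+2).

Lemma mem_lift_tangent y v : differentiable h v ->
  (y \in lift_tangent h v) = (y <= frame h v)%MS.
Proof.
move=> hd; apply/idP/idP => [/memv_addP[_ /vlineP[c ->]] [_ /memv_sumP[z zP ->] ->]|].
  apply: addmx_sub; first exact/scalemx_sub/h_sub_frame.
  apply: summx_sub => k _; have /vlineP[c' ->] := zP k isT.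
  exact/scalemx_sub/derive_sub_frame.
move=> /submxP[u ->].
rewrite -[u](@hsubmxK _ 1 1 n) mul_row_col mulmx_frame //.
rewrite [lsubmx u]mx11_scalar mul_scalar_mx rpredD //.
  by rewrite rpredZ // (subvP (addvSl _ _)) // memv_line.
exact: mem_lift_tangent_derive.
Qed.

Lemma lift_tangent_row_free v : differentiable h v ->
  \dim (lift_tangent h v) = n.+1 -> row_free (frame h v).
Proof.
move=> hd dimT; pose X := [tuple row i (frame h v) | i < 1 + n].
have TX : lift_tangent h v = <<X>>%VS.
  rewrite span_def big_tuple big_split_ord /= big_ord1; congr (_ + _)%VS.
    by rewrite tnth_mktuple; congr <[_]>%VS; apply/rowP => j; rewrite mxE col_mxEu.
  apply: eq_bigr => k _; rewrite tnth_mktuple; congr <[_]>%VS.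
  by apply/rowP => j; rewrite mxE col_mxEd mxE.
have /freeP fX : free X by rewrite /free -TX dimT size_tuple.
apply: inj_row_free => u u0; apply/rowP => i; rewrite mxE.
apply: (fX (fun i => u ord0 i)); rewrite -[RHS]u0 mulmx_sum_row.
by apply: eq_bigr => k _; rewrite -tnth_nth tnth_mktuple.
Qed.

End frames.

(** * Generators expressed by a lift and its polar vector *)

Section generators.
Context {R : realType} {n : nat} (G : 'M[R]_n.+2) (X : manifold R n)
  (phi : X -> pspace R n.+1).
Hypothesis Gsym : G^T = G.
Hypothesis Gunit : G \in unitmx.
Hypothesis phi_lightlike : lightlike_hypersurface G phi.

Lemma touches_atP v (h : 'rV[R]_n -> 'rV[R]_n.+2) A0 : differentiable h v ->
  row_free (frame h v) -> touches_at G (lift_tangent h v) A0 ->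
  bform G (polar G h v) (polar G h v) = 0 /\ pline A0 = <[polar G h v]>%VS.
Proof.
move=> hd hf [A0abs [a' A0a' a'T]]; set a := polar G h v.
have a'0 : bform G a' a' = 0 by apply: A0abs; rewrite A0a' memv_line.
have T' y : (bform G y a' == 0) = (y <= frame h v)%MS.
  rewrite -mem_lift_tangent //; apply/idP/idP.
    by move=> /eqP e; apply/a'T; rewrite derive_qform // e mulr0.
  by move=> /a'T; rewrite derive_qform // => /eqP; rewrite mulf_eq0 pnatr_eq0.
have Ta y : (bform G y a == 0) = (y <= frame h v)%MS by exact: bform_polar_eq0.
have a0 : a != 0 by exact: polar_neq0.
(* [a'] is null, so it lies in the hyperplane, that is, it is orthogonal to [a]; by symmetry of the
   form [a] lies in the hyperplane too. *)
have aa' : (a <= frame h v)%MS.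
  by rewrite -T' bformC // Ta -T' a'0.
split; first by apply/eqP; rewrite Ta.
have [y /eqP|mu amu] := @bform_ker_proportional _ _ G a' a Gunit.
  by rewrite T' -Ta => /eqP.
have mu0 : mu != 0 by apply: contraNneq a0 => mu0; rewrite amu mu0 scale0r.
rewrite A0a' amu; apply/eqP; rewrite eqEsubv -!memvE rpredZ ?memv_line // andbT.
by apply/vlineP; exists mu^-1; rewrite scalerA mulVf // scale1r.
Qed.

Lemma polar_touches v (h : 'rV[R]_n -> 'rV[R]_n.+2) (A0 : pspace R n.+1) :
  differentiable h v -> row_free (frame h v) ->
  bform G (polar G h v) (polar G h v) = 0 -> pline A0 = <[polar G h v]>%VS ->
  touches_at G (lift_tangent h v) A0.
Proof.
move=> hd hf aa A0a; split.
  move=> y; rewrite A0a => /vlineP[c ->].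
  by rewrite -[LHS]/(bform G _ _) bformZl bformZr aa !mulr0.
exists (polar G h v) => // y; rewrite derive_qform // mem_lift_tangent //.
rewrite -(bform_polar_eq0 _ Gsym Gunit hf); split=> [/eqP ->|/eqP].
  by rewrite mulr0.
by rewrite mulf_eq0 pnatr_eq0.
Qed.

Section at_point.
Variables (x : X) (i : chart X) (D : set 'rV[R]_n) (h : 'rV[R]_n -> 'rV[R]_n.+2).
Hypothesis hL : local_lift phi x i D h.
Let v := chart_map i x.

Lemma lift_differentiable : differentiable h v.
Proof. by have [_ _ Dx hs _] := hL; exact: smooth_differentiable hs Dx. Qed.

Lemma lift_tangent_space : tangent_space phi x (lift_tangent h v).
Proof. by exists i, D, h. Qed.

Lemma lift_frame_free : row_free (frame h v).
Proof.
apply: lift_tangent_row_free; first exact: lift_differentiable.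
exact: (lh_immersion phi_lightlike lift_tangent_space).
Qed.

Lemma lift_pline : pline (phi x) = <[h v]>%VS.
Proof. by have [dx _ Dx _ hphi] := hL; exact: hphi. Qed.

Lemma lift_positive : 0 < bform G (h v) (h v).
Proof.
apply: (lh_de_sitter phi_lightlike (x := x)).
  by rewrite lift_pline memv_line.
exact: pline_gen_neq0 lift_pline.
Qed.

Lemma lift_polar_null : bform G (polar G h v) (polar G h v) = 0.
Proof.
have [A0 tA0] := lh_lightlike phi_lightlike lift_tangent_space.
by have [] := touches_atP lift_differentiable lift_frame_free tA0.
Qed.

Lemma tangent_space_unique T : tangent_space phi x T -> T = lift_tangent h v.
Proof.
move=> xT; have [i' [D' [h' [hL' TE]]]] := xT.
apply/eqP; rewrite eqEdim (lh_immersion phi_lightlike xT).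
rewrite (lh_immersion phi_lightlike lift_tangent_space) leqnn andbT TE.
exact: lift_tangent_sub_lift hL hL'.
Qed.

(** Removes the choices of tangent space and contact point from [generator]: every lift at [x]
    determines one and the same line. *)
Lemma generatorP L : generator G phi x L <->
  L = [set r : pspace R n.+1 | (r <= <[h v]> + <[polar G h v]>)%VS].
Proof.
split=> [[T [A0 [xT tA0 ->]]]|->].
  rewrite (tangent_space_unique xT) in tA0.
  have [_ A0a] := touches_atP lift_differentiable lift_frame_free tA0.
  by rewrite /join_line A0a lift_pline.
have a0 : \dim <[polar G h v]>%VS == 1%N.
  by rewrite dim_vline polar_neq0 //; exact: lift_frame_free.
exists (lift_tangent h v), (PPoint a0); split.
- exact: lift_tangent_space.
- apply: polar_touches => //; [exact: lift_differentiable|exact: lift_frame_free|].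
  exact: lift_polar_null.
- by rewrite /join_line lift_pline.
Qed.

Lemma mem_generator_plane w : (w \in <[h v]> + <[polar G h v]>)%VS <->
  exists u : 'rV[R]_(1 + 1), w = u *m col_mx (h v) (polar G h v).
Proof.
split=> [/memv_addP[_ /vlineP[c ->] [_ /vlineP[c' ->] ->]]|[u ->]].
  exists (row_mx c%:M c'%:M).
  by rewrite mul_row_col !mul_scalar_mx.
rewrite -[u](@hsubmxK _ 1 1 1) mul_row_col [lsubmx u]mx11_scalar.
rewrite [rsubmx u]mx11_scalar !mul_scalar_mx.
by apply: memv_add; apply/vlineP;
  [exists (lsubmx u ord0 ord0)|exists (rsubmx u ord0 ord0)].
Qed.

Lemma generator_plane_free : row_free (col_mx (h v) (polar G h v)).
Proof.
apply: inj_row_free => u; rewrite -[u](@hsubmxK _ 1 1 1) mul_row_col.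
rewrite [lsubmx u]mx11_scalar [rsubmx u]mx11_scalar !mul_scalar_mx.
move: (lsubmx u _ _) (rsubmx u _ _) => c c' e.
have ha : bform G (h v) (polar G h v) = 0.
  apply/eqP; rewrite bform_polar_eq0 ?h_sub_frame //; exact: lift_frame_free.
have c0 : c = 0.
  have B0 : bform G (h v) 0 = 0 by rewrite /bform trmx0 mulmx0 mxE.
  have := congr1 (bform G (h v)) e; rewrite bformDr !bformZr ha mulr0 addr0 B0.
  by move/eqP; rewrite mulf_eq0 (gt_eqF lift_positive) orbF => /eqP.
move: e; rewrite c0 scale0r add0r => /eqP; rewrite scaler_eq0.
rewrite (negbTE (polar_neq0 Gunit lift_frame_free)) orbF => /eqP ->.
by apply/rowP => j; rewrite !mxE; case: splitP => k _; rewrite mxE mul0rn.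
Qed.

End at_point.

End generators.

(** * The manifold of slices *)

Lemma cluster_continuous (U V : topologicalType) (f : U -> V) (p q : U) :
  continuous f -> cluster (nbhs p) q -> cluster (nbhs (f p)) (f q).
Proof.
move=> fc pq P Q /(fc p) fP /(fc q) fQ.
by have [z [Pz Qz]] := pq _ _ fP fQ; exists (f z).
Qed.

(** * Countable disjoint unions as subsets of [nat * T] *)

Section sum_topology.
Context {T : topologicalType} (A : set (nat * T)).
Local Notation val := (set_val : A -> nat * T).

Lemma index_continuous : continuous (fun q : A => (val q).1).
Proof.
move=> q; apply: (@continuous_comp _ _ _ val fst); first exact: initial_continuous.
exact: cvg_fst.
Qed.

Lemma point_continuous : continuous (fun q : A => (val q).2).
Proof.
move=> q; apply: (@continuous_comp _ _ _ val snd); first exact: initial_continuous.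
exact: cvg_snd.
Qed.

Lemma index_open m : open [set q : A | (val q).1 = m].
Proof.
rewrite -[X in open X]/((fun q : A => (val q).1) @^-1` [set m]).
apply: open_comp => [q _|]; first exact: index_continuous.
exact: discrete_open.
Qed.

Lemma sum_hausdorff : hausdorff_space T -> hausdorff_space A.
Proof.
move=> hT p q pq; apply: val_inj.
have e1 : (val p).1 = (val q).1.
  exact/discrete_hausdorff/(cluster_continuous index_continuous pq).
have e2 : (val p).2 = (val q).2.
  exact/hT/(cluster_continuous point_continuous pq).
by move: e1 e2; rewrite set_valE; case: (\val p) (\val q) => ? ? [? ?] /= -> ->.
Qed.

Lemma sum_nbhs (q : A) (W : set A) : nbhs q W -> exists U : set T,
  nbhs (val q).2 U /\ [set p : A | (val p).1 = (val q).1 /\ U (val p).2] `<=` W.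
Proof.
case=> _ [] [V oV <-] Vq VW.
have /= [[P Q] [/= nP nQ] PQ] : nbhs (val q) V by exact: open_nbhs_nbhs.
exists Q; split => // p [pq Qp]; apply: VW; apply: PQ; split => //=.
by rewrite pq; exact: nbhs_singleton nP.
Qed.

Lemma sum_second_countable : @second_countable T -> @second_countable A.
Proof.
move=> [Bs cB [Bo Bb]].
pose W (mU : nat * set T) := [set p : A | (val p).1 = mU.1 /\ mU.2 (val p).2].
exists [set W mU | mU in setT `*` Bs].
  apply: sub_countable (card_image_le _ _) _.
  exact: countableX.
split.
  move=> _ [[m U] [_ /= BU] <-]; apply: openI; first exact: index_open.
  apply: open_comp => [q _|]; [exact: point_continuous|exact: Bo].
move=> q V /sum_nbhs[U [nU UV]].
have [U' [BU' U'q] U'U] := Bb _ _ nU.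
exists (W ((val q).1, U')); first by split; [exists ((val q).1, U')|split].
by move=> p [pq U'p]; apply: UV; split=> //; exact: U'U.
Qed.

End sum_topology.

(* [c] is a partial function from [nat] to [T], given as a relation because [T] may
   be empty. *)
Lemma lindelof_centers (T : topologicalType) (O : T -> set T) :
  @second_countable T -> (forall x, open (O x)) -> (forall x, O x x) ->
  exists c : nat -> T -> Prop,
    (forall m x y, c m x -> c m y -> x = y) /\
    forall x, exists m y, c m y /\ O y x.
Proof.
move=> [Bs /countable_injP[f finj] [_ Bb]] oO Oxx.
(* The number [m] codes a basic open set [U] contained in some [O x], and [cid] picks the centre. It
   depends on [U] alone, since any two proofs [e] are equal. *)
exists (fun m y => exists U (e : exists x, U `<=` O x),
  [/\ Bs U, f U = m & y = projT1 (cid e)]); split.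
  move=> m x y [U [e [BU fU ->]]] [U' [e' [BU' fU' ->]]].
  have UU' : U = U' by apply: finj; rewrite ?inE // fU fU'.
  by move: e'; rewrite -UU' => e'; rewrite (Prop_irrelevance e e').
move=> x; have [U [BU Ux] UO] := Bb x (O x) (open_nbhs_nbhs (conj (oO x) (Oxx x))).
have e : exists x, U `<=` O x by exists x.
exists (f U), (projT1 (cid e)); split; first by exists U, e.
by case: (cid e) => y /=; apply.
Qed.

(** * Slices that carry all generators near a point *)

Section patches.
Context {R : realType} {n : nat} (G : 'M[R]_n.+2) (X : manifold R n)
  (phi : X -> pspace R n.+1).
Hypothesis Gsym : G^T = G.
Hypothesis Gunit : G \in unitmx.
Hypothesis phi_lightlike : lightlike_hypersurface G phi.

(** Bare data: the laws are stated apart, by [local_lift] and [slice_exists], so that [choice] can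
    pick a patch at every point. *)
Record patch := Patch {
  pchart : chart X;
  pdom : set 'rV[R]_n;
  plift : 'rV[R]_n -> 'rV[R]_n.+2;
  pcoord : 'I_n
}.

Definition slice (x0 : X) (P : patch) : set X :=
  [set z | [/\ chart_dom (pchart P) z, pdom P (chart_map (pchart P) z)
    & chart_map (pchart P) z ord0 (pcoord P) =
      chart_map (pchart P) x0 ord0 (pcoord P)]].

Lemma slice_lift x0 P z : local_lift phi x0 (pchart P) (pdom P) (plift P) ->
  slice x0 P z -> local_lift phi z (pchart P) (pdom P) (plift P).
Proof.
move=> [_ oD _ hs hphi] [dz Dz _].
by split; [exact: dz|exact: oD|exact: Dz|exact: hs|exact: hphi].
Qed.

Lemma slice_exists (x0 : X) : exists (P : patch) (O : set X),
  [/\ local_lift phi x0 (pchart P) (pdom P) (plift P), open O, O x0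
    & forall x, O x -> exists s, slice x0 P s /\
        forall L, generator G phi x L -> generator G phi s L].
Proof.
have [i [D0 [h hL]]] := lh_smooth phi_lightlike x0.
have [dx0 oD0 D0x0 hs hphi] := hL.
(* Outside the image of the chart [h] is not tied to [phi]; moreover the point found on the slice
   has to come from a point of [X]. *)
pose D := D0 `&` (chart_map i @` chart_dom i).
have oD : open D by apply: openI => //; exact: chart_img_open.
have DL w : D w -> local_lift phi (chart_inv i w) i D0 h /\
    chart_map i (chart_inv i w) = w.
  by move=> [D0w /chart_inv_img[dw cw]]; split=> //; split=> //; rewrite cw.
have hsD : smooth_on D h by move=> k; apply: Ck_on_sub (hs k) => ? [].
have free w : D w -> row_free (frame h w).
  by move=> /DL[L cw]; have := lift_frame_free phi_lightlike L; rewrite cw.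
have pos w : D w -> 0 < bform G (h w) (h w).
  by move=> /DL[L cw]; have := lift_positive phi_lightlike L; rewrite cw.
have null w : D w -> bform G (polar G h w) (polar G h w) = 0.
  by move=> /DL[L cw]; have := lift_polar_null Gsym Gunit phi_lightlike L; rewrite cw.
have Dx0 : D (chart_map i x0) by split => //; exists x0.
have [k [r r0 Hr]] := generator_meets_slice Gsym Gunit oD hsD free pos null Dx0.
have c0 : {for x0, continuous (chart_map i)} by exact: chart_map_continuous.
exists (Patch i D0 h k),
  ([set x | chart_dom i x /\ `|chart_map i x - chart_map i x0| < r]).
split.
- by [].
- rewrite openE => x [dx xr]; apply: filterI.
    by apply: open_nbhs_nbhs; split => //; exact: chart_dom_open.
  have cx : {for x, continuous (chart_map i)} by exact: chart_map_continuous.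
  have xc : `|chart_map i y - chart_map i x0| @[y --> x] -->
      `|chart_map i x - chart_map i x0|.
    apply: (@cvg_norm _ _ _ (nbhs x)); apply: (@cvgB _ _ _ (nbhs x)); first exact: cx.
    exact: cvg_cst.
  exact: cvgr_lt xc _ xr.
- by split => //; rewrite subrr normr0.
- move=> x [dx /Hr[Dx [s [Ds sk e]]]].
  have [dsi cs] := chart_inv_img Ds.2.
  exists (chart_inv i s); split.
    by split; [exact: dsi|rewrite cs; exact: Ds.1|rewrite cs; exact: sk].
  have xL : local_lift phi x i D0 h.
    by split; [exact: dx|exact: oD0|exact: Dx.1|exact: hs|exact: hphi].
  move=> L /(generatorP Gsym Gunit phi_lightlike xL) ->.
  apply/(generatorP Gsym Gunit phi_lightlike (DL _ Ds).1).
  by rewrite cs e.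
Qed.

End patches.

(** * Coordinates on a coordinate hyperplane *)

Section hyperplane_coordinates.
Context {R : realType} {d : nat}.
Implicit Types (k : 'I_d.+1) (c : R) (y : 'rV[R]_d) (v : 'rV[R]_d.+1).

(** Written as a constant plus a matrix product, so that the calculus of affine maps applies. *)
Definition insert_coord k c y : 'rV[R]_d.+1 :=
  c *: delta_mx ord0 k + y *m row' k 1%:M.

Definition drop_coord k v : 'rV[R]_d := v *m (row' k 1%:M)^T.

Lemma insert_coord_at k c y : insert_coord k c y ord0 k = c.
Proof.
rewrite !mxE !eqxx mulr1 big1 ?addr0 // => i _.
by rewrite !mxE eq_sym (negbTE (neq_lift _ _)) mulr0.
Qed.

Lemma insert_coord_lift k c y i : insert_coord k c y ord0 (lift k i) = y ord0 i.
Proof.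
rewrite !mxE eqxx eq_sym (negbTE (neq_lift _ _)) mulr0 add0r.
rewrite (bigD1 i) //= big1 ?addr0 => [|j ji]; rewrite !mxE ?eqxx ?mulr1 //.
by rewrite (inj_eq lift_inj) (negbTE ji) mulr0.
Qed.

Lemma drop_coordE k v i : drop_coord k v ord0 i = v ord0 (lift k i).
Proof.
rewrite mxE (bigD1 (lift k i)) //= big1 ?addr0 => [|j ji]; rewrite !mxE ?eqxx ?mulr1 //.
by rewrite eq_sym (negbTE ji) mulr0.
Qed.

Lemma insert_coordK k c : cancel (insert_coord k c) (drop_coord k).
Proof. by move=> y; apply/rowP => i; rewrite drop_coordE insert_coord_lift. Qed.

Lemma drop_coordK k v : insert_coord k (v ord0 k) (drop_coord k v) = v.
Proof.
apply/rowP => j; case: (unliftP k j) => [i|] ->; last exact: insert_coord_at.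
by rewrite insert_coord_lift drop_coordE.
Qed.

Lemma drop_coord_continuous k : continuous (drop_coord k).
Proof. exact: (@linear_rV_continuous _ _ _ (mulmxr (row' k 1%:M)^T)). Qed.

Lemma insert_coord_continuous k c : continuous (insert_coord k c).
Proof.
move=> y; apply: differentiable_continuous.
exact: (@differentiable_affine_rV _ _ _ (mulmxr (row' k 1%:M)) (c *: delta_mx ord0 k)).
Qed.

End hyperplane_coordinates.

(** * The manifold of slices and its ruling *)

Section leaf_space.
Context {R : realType} {d : nat} (G : 'M[R]_d.+3) (X : manifold R d.+1)
  (phi : X -> pspace R d.+2).
Variables (P : X -> patch X) (c : nat -> X -> Prop).
Hypothesis P_lift : forall x0,
  local_lift phi x0 (pchart (P x0)) (pdom (P x0)) (plift (P x0)).
Hypothesis c_unique : forall m x y, c m x -> c m y -> x = y.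

(** The index keeps slices apart that overlap in [X], and makes each of them open in the union. *)
Definition leaf_set : set (nat * X) :=
  [set q | exists x0, c q.1 x0 /\ slice x0 (P x0) q.2].
Local Notation M := (leaf_set : Type).
Local Notation val := (set_val : M -> nat * X).
Implicit Types q : M.

Lemma center_exists q : exists x0, c (val q).1 x0 /\ slice x0 (P x0) (val q).2.
Proof. by have := set_valP q. Qed.

Definition center q : X := projT1 (cid (center_exists q)).

Lemma centerP q : c (val q).1 (center q) /\ slice (center q) (P (center q)) (val q).2.
Proof. exact: projT2 (cid (center_exists q)). Qed.

Lemma center_eq q q' : (val q).1 = (val q').1 -> center q = center q'.
Proof.
move=> e; have [cq _] := centerP q; have [cq' _] := centerP q'.
by apply: (c_unique cq); rewrite e.
Qed.

Definition leaf_patch q := P (center q).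
Definition leaf_level q : R :=
  chart_map (pchart (leaf_patch q)) (center q) ord0 (pcoord (leaf_patch q)).
Definition leaf_section q : 'rV[R]_d -> 'rV[R]_d.+1 :=
  insert_coord (pcoord (leaf_patch q)) (leaf_level q).
Definition leaf_point q (y : 'rV[R]_d) : nat * X :=
  ((val q).1, chart_inv (pchart (leaf_patch q)) (leaf_section q y)).

(** A single chart covers a whole slice; [q] only serves to name the slice. *)
Definition leaf_dom q : set M := [set q' | (val q').1 = (val q).1].
Definition leaf_map q (q' : M) : 'rV[R]_d :=
  drop_coord (pcoord (leaf_patch q)) (chart_map (pchart (leaf_patch q)) (val q').2).
(* The value [q] off [leaf_img q] is junk. *)
Definition leaf_inv q (y : 'rV[R]_d) : M :=
  if pselect (leaf_set (leaf_point q y)) is left H then SigSub (mem_set H) else q.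
Definition leaf_img q : set 'rV[R]_d :=
  leaf_section q @^-1` (pdom (leaf_patch q) `&`
    (chart_map (pchart (leaf_patch q)) @` chart_dom (pchart (leaf_patch q)))).

Lemma leaf_img_open q : open (leaf_img q).
Proof.
apply: open_comp => [y _|]; first exact: insert_coord_continuous.
apply: openI; last exact: chart_img_open.
by have [] := P_lift (center q).
Qed.

Lemma leaf_slice q q' : leaf_dom q q' ->
  slice (center q) (leaf_patch q) (val q').2.
Proof. by rewrite /leaf_patch => /center_eq <-; have [] := centerP q'. Qed.

Lemma leaf_mapE q q' : leaf_dom q q' ->
  leaf_section q (leaf_map q q') = chart_map (pchart (leaf_patch q)) (val q').2.
Proof.
by move=> /leaf_slice[_ _ k]; rewrite /leaf_section /leaf_level -k drop_coordK.
Qed.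

Lemma leaf_invE q y : leaf_img q y -> val (leaf_inv q y) = leaf_point q y.
Proof.
move=> [Dy iy]; rewrite /leaf_inv; case: pselect => [H //|]; case.
have [dy cy] := chart_inv_img iy; exists (center q).
split; first by have [] := centerP q.
split; rewrite /= -/(leaf_patch q) ?cy //.
exact: insert_coord_at.
Qed.

Lemma leaf_inv_dom q y : leaf_img q y -> leaf_dom q (leaf_inv q y).
Proof. by move=> /leaf_invE e; rewrite /leaf_dom /= e. Qed.

Lemma leaf_invK q y : leaf_img q y -> leaf_map q (leaf_inv q y) = y.
Proof.
move=> yi; rewrite /leaf_map leaf_invE //=.
by have [_ ->] := chart_inv_img yi.2; exact: insert_coordK.
Qed.

Lemma leaf_map_img q q' : leaf_dom q q' -> leaf_img q (leaf_map q q').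
Proof.
move=> qq'; have [dq Dq _] := leaf_slice qq'.
by split; rewrite leaf_mapE //; exists (val q').2.
Qed.

Lemma leaf_imgE q : leaf_map q @` leaf_dom q = leaf_img q.
Proof.
apply/seteqP; split=> [_ [q' qq' <-]|y yi]; first exact: leaf_map_img.
by exists (leaf_inv q y); [exact: leaf_inv_dom|exact: leaf_invK].
Qed.

Lemma leaf_mapK q q' : leaf_dom q q' -> leaf_inv q (leaf_map q q') = q'.
Proof.
move=> qq'; apply: val_inj; rewrite -!set_valE.
rewrite leaf_invE; last exact: leaf_map_img.
rewrite /leaf_point leaf_mapE //; have [dq _ _] := leaf_slice qq'.
by rewrite chart_mapK // -qq'; case: (val q').
Qed.

Lemma leaf_map_continuous q q' : leaf_dom q q' -> {for q', continuous (leaf_map q)}.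
Proof.
move=> /leaf_slice[dq _ _].
apply: (@continuous_comp _ _ _ (fun q => chart_map (pchart (leaf_patch _)) (val q).2)
  (drop_coord _)); last exact: drop_coord_continuous.
apply: (@continuous_comp _ _ _ (fun q => (val q).2)); first exact: point_continuous.
exact: chart_map_continuous.
Qed.

Lemma leaf_inv_continuous q y : leaf_img q y -> {for y, continuous (leaf_inv q)}.
Proof.
move=> yi W /sum_nbhs[U [nU UW]].
have cs : {for y, continuous (chart_inv (pchart (leaf_patch q)) \o leaf_section q)}.
  apply: continuous_comp; first exact: insert_coord_continuous.
  exact: chart_inv_continuous yi.2.
rewrite leaf_invE // in nU UW.
have near_img : nbhs y (leaf_img q).
  by apply: open_nbhs_nbhs; split=> //; exact: leaf_img_open.
have near_U := cs U nU.
apply: filterS (filterI near_img near_U) => z [zi Uz].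
by apply: UW; rewrite /= leaf_invE.
Qed.

(** Two charts either belong to the same slice and coincide, or have disjoint domains, so every
    transition is the identity on an open set. *)
Lemma leaf_transition q q' :
  smooth_on (leaf_map q @` (leaf_dom q `&` leaf_dom q')) (leaf_map q' \o leaf_inv q).
Proof.
set S := leaf_map q @` _.
have SE : S = [set y | leaf_img q y /\ (val q).1 = (val q').1].
  apply/seteqP; split=> [_ [z [qz q'z] <-]|y [yi e]].
    by split; [exact: leaf_map_img|rewrite -qz].
  exists (leaf_inv q y); last exact: leaf_invK.
  by split; [exact: leaf_inv_dom|rewrite /leaf_dom /= -e; exact: leaf_inv_dom].
have oS : open S.
  have [e|e] := pselect ((val q).1 = (val q').1).
    have -> : S = leaf_img q by rewrite SE; apply/seteqP; split=> [y []|y].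
    exact: leaf_img_open.
  have -> : S = set0 by rewrite SE; apply/seteqP; split=> [y []|y].
  exact: open0.
move=> k; apply: (Ck_on_ext oS (@Ck_linear_rV _ _ _ k S idfun)) => y /=.
rewrite SE => -[yi e]; rewrite /leaf_map /leaf_patch -(center_eq e).
exact/esym/leaf_invK.
Qed.

(** The charts are indexed by the points themselves, which includes the case of an empty
    manifold. *)
Definition leaf_manifold : manifold R d.
Proof.
apply: (@Manifold R d M M leaf_dom leaf_map leaf_inv).
- exact: sum_hausdorff (@points_hausdorff _ _ X).
- exact: sum_second_countable (@points_second_countable _ _ X).
- by move=> q; exists q.
- by move=> q; exact: index_open.
- by move=> q; rewrite leaf_imgE; exact: leaf_img_open.
- exact: leaf_mapK.
- exact: leaf_map_continuous.
- by move=> q y; rewrite leaf_imgE; exact: leaf_inv_continuous.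
- exact: leaf_transition.
Defined.


Hypothesis Gsym : G^T = G.
Hypothesis Gunit : G \in unitmx.
Hypothesis phi_lightlike : lightlike_hypersurface G phi.

Lemma leaf_lift q q' : leaf_dom q q' ->
  local_lift phi (val q').2 (pchart (leaf_patch q)) (pdom (leaf_patch q))
    (plift (leaf_patch q)).
Proof. by move=> /leaf_slice; apply: slice_lift; exact: P_lift. Qed.

Definition leaf_plane q (v : 'rV[R]_d.+1) : 'M[R]_(1 + 1, d.+3) :=
  col_mx (plift (leaf_patch q) v) (polar G (plift (leaf_patch q)) v).

Definition leaf_ruling q : 'M[R]_(1 + 1, d.+3) :=
  leaf_plane q (chart_map (pchart (leaf_patch q)) (val q).2).

Lemma leaf_ruling_free q : row_free (leaf_ruling q).
Proof.
exact: (generator_plane_free Gsym Gunit phi_lightlike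
  (leaf_lift (erefl : leaf_dom q q))).
Qed.

Lemma leaf_generator q : exists2 L, generator G phi (val q).2 L &
  L = [set r : pspace R d.+2 | forall w, w \in pline r ->
         exists u : 'rV[R]_(1 + 1), w = u *m leaf_ruling q].
Proof.
have qL := leaf_lift (erefl : leaf_dom q q).
eexists; first exact/(generatorP Gsym Gunit phi_lightlike qL).
apply/seteqP; split=> r /= rL.
  by move=> w /(subvP rL) /(mem_generator_plane G).
by apply/subvP => w /rL /(mem_generator_plane G).
Qed.

Lemma ruling_image_dim q (t : pspace R 1) :
  \dim <[vpick t *m leaf_ruling q]>%VS == 1%N.
Proof. by rewrite dim_vline mulmx_free_eq0 ?leaf_ruling_free // vpick_neq0. Qed.

Definition ruling (q : leaf_manifold) (t : pspace R 1) : pspace R d.+2 :=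
  PPoint (ruling_image_dim q t).

(** The image does not depend on the representative that [vpick] selects in the definition of
    [ruling]. *)
Lemma ruling_line (q : leaf_manifold) (t : pspace R 1) (b : 'rV[R]_2) :
  t = <[b]>%VS :> {vspace _} -> pline (ruling q t) = <[b *m leaf_ruling q]>%VS.
Proof.
move=> tb; have /vlineP[e pe] : vpick t \in <[b]>%VS by rewrite -tb memv_pick.
have e0 : e != 0 by apply: contraNneq (vpick_neq0 t) => e0; rewrite pe e0 scale0r.
rewrite /= pe -scalemxAl; apply/eqP; rewrite eqEsubv -!memvE rpredZ ?memv_line //=.
by apply/vlineP; exists e^-1; rewrite scalerA mulVf // scale1r.
Qed.

Lemma ruling_bij (q : leaf_manifold) : exists2 L, generator G phi (val q).2 L &
  set_bij [set: pspace R 1] L (ruling q).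
Proof.
have [L qL LE] := leaf_generator q; exists L => //; split.
- move=> t _; rewrite LE => w; rewrite (ruling_line q (pline_vpick t)).
  by move=> /vlineP[e ->]; exists (e *: vpick t); rewrite scalemxAl.
- move=> t t' _ _ /(congr1 (@pline _ _)).
  rewrite (ruling_line q (pline_vpick t)) (ruling_line q (pline_vpick t')) => e.
  apply: pspace_eq; apply/eqP; rewrite eqEdim (eqP (pline_dim t)) (eqP (pline_dim t')).
  rewrite leqnn andbT (pline_vpick t) -memvE.
  have /vlineP[c' /eqP] : vpick t *m leaf_ruling q \in <[vpick t' *m leaf_ruling q]>%VS.
    by rewrite -e memv_line.
  rewrite scalemxAl -subr_eq0 -mulmxBl mulmx_free_eq0 ?leaf_ruling_free //.
  by rewrite subr_eq0 => /eqP ->; rewrite rpredZ // memv_pick.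
- move=> r; rewrite LE => /(_ _ (memv_pick r))[u ru].
  have u0 : \dim <[u : 'rV[R]_2]>%VS == 1%N.
    rewrite dim_vline; suff -> : u != 0 by [].
    apply/eqP => u0; have := vpick_neq0.
    have := pline_dim r; rewrite (pline_vpick r) ru u0 mul0mx dim_vline eqxx //.
  exists (PPoint u0) => //; apply: pspace_eq.
  by rewrite (ruling_line q (b := u)) // (pline_vpick r) ru.
Qed.

Lemma ruling_smooth : smooth_prod_map ruling.
Proof.
move=> q b b0.
(* [leaf_section q] after the projection to the slice coordinates is affine; [F] is its linear part,
   as [Ck_comp_affine] requires. *)
pose F := [the {linear 'rV[R]_(d + 2) -> 'rV[R]_d.+1} of
  mulmxr (row' (pcoord (leaf_patch q)) 1%:M) \o lsubmx].
pose Af := fun u : 'rV[R]_(d + 2) =>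
  leaf_level q *: delta_mx ord0 (pcoord (leaf_patch q)) + F u.
have AfE u : Af u = leaf_section q (lsubmx u) by [].
have [_ oD _ hs _] := leaf_lift (erefl : leaf_dom q q).
have as_ := smooth_polar G oD hs.
have Ad u : differentiable Af u by exact: differentiable_affine_rV.
have DA u w : 'D_w Af u = F w by exact: derive_affine_rV.
have oAD : open (Af @^-1` pdom (leaf_patch q)).
  by apply: open_comp => // u _; exact/differentiable_continuous/Ad.
(* The lift combines the two rows spanning the generator, with the homogeneous coordinates on the
   projective line as coefficients. *)
exists q, (Af @^-1` pdom (leaf_patch q)),
  (fun u => rsubmx u *m leaf_plane q (Af u)); split.
- by [].
- exact: oAD.
- rewrite /= AfE row_mxKl leaf_mapE //.
  by have [_ ? _] := leaf_slice (erefl : leaf_dom q q).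
- apply: smooth_mulmx => //.
    by move=> k; exact: (@Ck_linear_rV _ _ _ k _ (@rsubmx R 1 d 2)).
  move=> i j k; case: (@split_ordP 1 1 i) => i' ->.
    have -> : (fun u => leaf_plane q (Af u) (lshift 1 i') j) =
        (fun v => plift (leaf_patch q) v ord0 j) \o Af.
      by apply/funext => u; rewrite /leaf_plane col_mxEu ord1.
    by apply: (Ck_comp_affine oD Ad DA); apply: Ck_entry => //; exact: hs.
  have -> : (fun u => leaf_plane q (Af u) (rshift 1 i') j) =
      (fun v => polar G (plift (leaf_patch q)) v ord0 j) \o Af.
    by apply/funext => u; rewrite /leaf_plane col_mxEd ord1.
  by apply: (Ck_comp_affine oD Ad DA); apply: Ck_entry => //; exact: as_.
- move=> z b' t qz _ tb.
  have rb : rsubmx (row_mx (leaf_map q z) b') = b' := row_mxKr _ _.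
  have zE : leaf_ruling z = leaf_plane q (Af (row_mx (leaf_map q z) b')).
    rewrite AfE row_mxKl (leaf_mapE qz) /leaf_ruling /leaf_plane /leaf_patch.
    by rewrite (center_eq qz).
  by apply: (etrans (ruling_line z tb)); rewrite zE -{1}rb.
Qed.

End leaf_space.

Theorem theorem1 (R : realType) (n : nat) (n_gt0 : (0 < n)%N)
    (G : 'M[R]_n.+2) (G_sig : has_signature n.+1 1 G)
    (X : manifold R n) (phi : X -> pspace R n.+1)
    (phi_lightlike : lightlike_hypersurface G phi) :
  exists (M : manifold R n.-1) (f : M -> pspace R 1 -> pspace R n.+1),
    [/\ smooth_prod_map f,
        completed G phi = [set p | exists m t, f m t = p]
      & forall m : M, exists x L,
          generator G phi x L /\ set_bij [set: pspace R 1] L (f m)].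
Proof.
(* A slice fixes one of [n = d.+1] coordinates, and [n.-1] becomes its dimension [d]. *)
case: n n_gt0 G G_sig X phi phi_lightlike => [//|d] _ G G_sig X phi phi_lightlike /=.
have Gunit := signature_unitmx G_sig.
have Gsym : G^T = G by case: G_sig.
have [P /choice[U HU]] := choice (slice_exists Gsym Gunit phi_lightlike).
have P_lift x0 : local_lift phi x0 (pchart (P x0)) (pdom (P x0)) (plift (P x0)).
  by have [] := HU x0.
have [|||c [c_unique c_cover]] := @lindelof_centers X U.
- exact: points_second_countable.
- by move=> x; have [] := HU x.
- by move=> x; have [] := HU x.
pose f : leaf_manifold P_lift c_unique -> pspace R 1 -> pspace R d.+2 :=
  ruling Gsym Gunit phi_lightlike.
have f_bij (q : leaf_manifold P_lift c_unique) :
    exists2 L, generator G phi (set_val q).2 L & set_bij [set: pspace R 1] L (f q).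
  exact: ruling_bij.
exists (leaf_manifold P_lift c_unique), f; split.
- exact: ruling_smooth.
- apply/seteqP; split=> [p [x [L [xL Lp]]]|p [m [t <-]]].
    have [m [y [my yx]]] := c_cover x.
    have [_ _ _ /(_ x yx)[s [ys /(_ L xL) sL]]] := HU y.
    have qA : leaf_set P c (m, s) by exists y.
    pose q : leaf_manifold P_lift c_unique := SigSub (mem_set qA).
    have [L' qL' [_ _ surj]] := f_bij q.
    (* The generator through [x] is also one through [s], and a lift at [s] leaves room for only
       one. *)
    have LL' : L = L'.
      have sE := generatorP Gsym Gunit phi_lightlike (slice_lift (P_lift y) ys).
      exact: etrans ((sE L).1 sL) (esym ((sE L').1 qL')).
    move: Lp; rewrite LL' => /surj[t _ <-].
    by exists q, t.
  have [L mL [fL _ _]] := f_bij m.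
  by eexists; exists L; split; [exact: mL|exact: fL].
- move=> m; have [L mL bijL] := f_bij m.
  by eexists; exists L; split; [exact: mL|exact: bijL].
Qed.
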